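(* Let $N\ge 2$. Let $f\in C^2(\mathbb{R})$ be convex and monotone increasing with $f(0)>0$ and $\lim_{s\to\infty} f(s)/s=+\infty$, and set $a_*:=\min_{s>0} f(s)/s$. For $\varepsilon\in(0,1)$ let $$\Omega_\varepsilon:=\Big\{(x_1,\dots,x_{N+1})\in\mathbb{R}^{N+1}\,:\,\sum_{i=1}^{N+1}x_i^2=1,\ \cos((1-\varepsilon)\pi)<x_{N+1}\le 1\Big\}\subset\mathbb{S}^N,$$ let $\lambda_1(\Omega_\varepsilon)$ be the principal Dirichlet eigenvalue of $-\Delta_{\mathbb{S}^N}$ in $\Omega_\varepsilon$, and let $$\lambda^*_{\Omega_\varepsilon}:=\sup\{\lambda>0:\ \text{the problem } -\Delta_{\mathbb{S}^N}u=\lambda f(u)\text{ in }\Omega_\varepsilon,\ u=0\text{ on }\partial\Omega_\varepsilon \text{ has a classical positive solution}\}.$$ Then, as $\varepsilon\to 0$, $$\lambda^*_{\Omega_\varepsilon}=\frac{\lambda_1(\Omega_\varepsilon)}{a_*}\,(1+o(1)).$$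
   Context: $\Delta_{\mathbb{S}^N}$ is the Laplace–Beltrami operator on the unit sphere $\mathbb{S}^N\subset\mathbb{R}^{N+1}$. Under the assumptions on $f$, $a_*>0$. *)

(* Defs.v *)
From HB Require Import structures.
From mathcomp Require Import all_boot all_order all_algebra.
From mathcomp Require Import all_classical all_reals all_analysis.
Set Implicit Arguments. Unset Strict Implicit. Unset Printing Implicit Defensive.
Import Order.TTheory GRing.Theory Num.Theory.
Import numFieldNormedType.Exports.
Local Open Scope classical_set_scope.
Local Open Scope ring_scope.

Section Defs.
Variables (R : realType) (N : nat).

(* Points of R^{N+1} are row vectors; coordinate x_{N+1} is x 0 ord_max. *)
Notation V := 'rV[R]_N.+1.

(* Euclidean norm (the library norm on matrices is the max norm). *)
Definition enorm (x : V) : R := Num.sqrt (\sum_(i < N.+1) x 0 i ^+ 2).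

Definition sphere : set V := [set x | \sum_(i < N.+1) x 0 i ^+ 2 = 1].

Definition cap (eps : R) : set V :=
  [set x | sphere x /\ cos ((1 - eps) * pi) < x 0 ord_max <= 1].

Definition cap_bd (eps : R) : set V :=
  [set x | sphere x /\ x 0 ord_max = cos ((1 - eps) * pi)].
Definition cap_cl (eps : R) : set V := cap eps `|` cap_bd eps.

Definition hext (u : V -> R) : V -> R := fun x => u ((enorm x)^-1 *: x).

Definition evec (i : 'I_N.+1) : V := delta_mx 0 i.

Definition lapl (g : V -> R) (x : V) : R :=
  \sum_(i < N.+1) derive (fun y => derive g y (evec i)) x (evec i).

(* Laplace-Beltrami on S^N: Delta_S u (x) = Delta (u(./|.|)) (x), |x| = 1 *)
Definition lapS (u : V -> R) (x : V) : R := lapl (hext u) x.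

Definition C2_near (g : V -> R) (A : set V) : Prop :=
  exists U : set V, open U /\ A `<=` U /\
    forall x, U x ->
      differentiable g x /\
      (forall v : V, differentiable (fun y => derive g y v) x) /\
      (forall v w : V,
         {for x, continuous (fun y => derive (fun z => derive g z v) y w)}).

Definition classical_dirichlet (eps : R) (u : V -> R) : Prop :=
  C2_near (hext u) (cap eps) /\
  {within cap_cl eps, continuous u} /\
  (forall x, cap_bd eps x -> u x = 0).

Definition classical_pos_sol (f : R -> R) (eps lam : R) (u : V -> R) : Prop :=
  classical_dirichlet eps u /\
  (forall x, cap eps x -> 0 < u x) /\
  (forall x, cap eps x -> - lapS u x = lam * f (u x)).

Definition lamstar (f : R -> R) (eps : R) : \bar R :=
  ereal_sup [set lam%:E | lam in
     [set lam : R | 0 < lam /\ exists u, classical_pos_sol f eps lam u]].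

Definition dir_eigenvalue (eps lam : R) : Prop :=
  exists u : V -> R, classical_dirichlet eps u /\
    (exists x, cap eps x /\ u x != 0) /\
    (forall x, cap eps x -> - lapS u x = lam * u x).

Definition lambda1 (eps : R) : R := inf [set lam | dir_eigenvalue eps lam].

End Defs.

Definition astar (R : realType) (f : R -> R) : R :=
  inf [set f s / s | s in [set s : R | 0 < s]].

(* Main.v *)
Require Import Defs.
From HB Require Import structures.
From mathcomp Require Import all_boot all_order all_algebra.
From mathcomp Require Import all_classical all_reals all_analysis.
From mathcomp Require Import ring lra.
Import Order.TTheory GRing.Theory Num.Theory.
Import numFieldNormedType.Exports.
Local Open Scope classical_set_scope.
Local Open Scope ring_scope.
Set Implicit Arguments.
Unset Strict Implicit.
Unset Printing Implicit Defensive.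

(* With [t = 1 - x_N] and [T = 1 - cos ((1 - eps) * pi)], functions of [t] are
   governed by [L w = t(2-t)w'' + N(1-t)w'] on [0 <= t < T], and [T -> 2] as
   [eps -> 0].  Let [D] be the solution of [L D = 1] regular at the pole with
   [D 0 = 0]; then [D T - D] is the torsion function of the cap, [D T] is its
   maximum, and [D T -> +oo] as [T -> 2].  Everything is compared with [1 / D T].
   - A positive strict supersolution of [- Delta W = nu W] forces every Dirichlet
     eigenvalue above [nu] (compare at the maximum of [v / W]).  Taking for [W] the
     torsion function plus a constant gives [1 / D T <= lambda1]; taking a positive
     solution plus a constant, where [f u >= a_* u] and [f u >= f 0 > 0], gives
     [lam * a_* <= lambda1], i.e. [lambda^* <= lambda1 / a_*].
   - The hypergeometric solution [1 - l D_l] of [L w = - l w] satisfies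
     [D_l >= (1 - l) D], so it vanishes at [T] for some [l <= (1 + o(1)) / D T].
     Hence [lambda1 = (1 + o(1)) / D T].
   - By convexity [f] is [a_*]-Lipschitz on [[0, s]], where [f s = a_* s].  Since the
     radial Green operator has sup norm [D T], the Picard iteration for
     [lam = k / (a_* D T)], [k < 1], is a contraction preserving [0 <= w <= s].
     Hence [lambda^* >= 1 / (a_* D T)]. *)

(** The delicate point is the pole [t = 0]: there [L] degenerates, yet solutions must be C^2 on an
    open set of R^{N+1} containing the pole. The variable [t], unlike the polar angle, is smooth
    there, so it is enough that a profile be C^2 across [t = 0], on both sides. Power series give
    this at once; the Picard solution gets it from a first-order expansion at 0 and an affine
    extension of its derivative to [t < 0]. [lambda1] is an infimum over all Dirichlet eigenvalues,
    with eigenfunctions of any sign: the comparison bounds each of them from below, and one explicit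
    eigenfunction bounds the infimum from above. The inequality [lam * a_* <= mu] holds on every cap
    for every eigenvalue [mu]; smallness of [eps] enters through [lambda1 <= (1 + eta) / D T]. That
    [D T] tends to infinity comes from [N >= 2]: the coefficients of [D], multiplied by [2^k],
    dominate a harmonic series. The coefficients of [D_l] have the factor [l] divided out, so that
    [l = 0] yields the torsion function rather than a constant. *)

Section tools.
Context {R : realType}.

Lemma near_eq_differentiable (V : normedModType R) (f g : V -> R) (x : V) :
  (\near x, f x = g x) -> differentiable g x -> differentiable f x.
Proof.
move=> fg dg.
have fgx : f x = g x by exact: (nbhs_singleton fg).
apply/diffP.
(* ['d f x] is selected by [get] among continuous linear maps with the first-order expansion, so it
   suffices to exhibit one, namely ['d g x]. *)
apply: (@getPex _ (fun (df : {linear V -> R}) => continuous df /\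
  forall y, f y = f (lim (nbhs x)) + df (y - lim (nbhs x))
                  +o_(y \near x) (y - lim (nbhs x)))).
exists ('d g x); split; first exact: diff_continuous.
rewrite lim_id//.
have /diffE/= dgx := dg.
pose T y : R := g x + 'd g x (y - x).
have /eqaddoP gT : g = T +o_x (fun y : V => y - x).
  by apply: eqaddoE; apply/funext => y; rewrite {1}dgx lim_id.
have fT : f = T +o_x (fun y : V => y - x).
  apply/eqaddoP => e e0; move: (gT _ e0) fg; apply: filterS2 => h /= + fgh.
  by rewrite -[(f - _) h]/(f h - T h) fgh.
by apply: eqaddoEx => y; rewrite {1}fT fgx.
Qed.

Lemma differentiable_chain (V : normedModType R) (g : V -> R) (phi : R -> R)
    (x : V) (d : R) :
  differentiable g x -> is_derive (g x) 1 phi d ->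
  differentiable (phi \o g) x /\
  forall v, 'D_v (phi \o g) x = d * 'D_v g x.
Proof.
move=> dg dphi.
have dphi' : differentiable phi (g x) by apply/derivable1_diffP; case: dphi.
have dc : differentiable (phi \o g) x by exact: differentiable_comp.
split=> // v; rewrite deriveE// diff_comp//= deriveE//.
by rewrite diff1E//= derive1E derive_val -[_ *: _]/(_ * _) mulrC.
Qed.

Lemma nondecreasing_of_derive (A A' : R -> R) (a b : R) : a <= b ->
  (forall x, a < x < b -> is_derive x 1 A (A' x)) ->
  (forall x, a < x < b -> 0 <= A' x) ->
  (forall x, a <= x <= b -> {for x, continuous A}) ->
  A a <= A b.
Proof.
move=> ab dA A0 cA; rewrite -subr_ge0.
(* The intermediate point may be an endpoint, where nothing is known of [A']; the value 0 there
   keeps the sign. *)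
have [x|x xab|c cab ->] := @MVT_segment R A (fun x => if a < x < b then A' x else 0) a b ab.
- by rewrite in_itv/= => xab; rewrite xab; exact: dA.
- by apply: continuous_in_subspaceT; move=> y; rewrite inE/= in_itv/=; exact: cA.
- by rewrite mulr_ge0 ?subr_ge0//; case: ifPn => // /A0.
Qed.
End tools.

(** * Functions on the sphere depending on the last coordinate *)

Section pointwise_continuity.
Context {R : realType} {X : topologicalType}.
Implicit Types (f g : X -> R) (x : X).

Lemma continuous_mulf f g x : {for x, continuous f} -> {for x, continuous g} ->
  {for x, continuous (fun y => f y * g y)}.
Proof. by move=> cf cg; exact: continuousM. Qed.

Lemma continuous_addf f g x : {for x, continuous f} -> {for x, continuous g} ->
  {for x, continuous (fun y => f y + g y)}.
Proof. by move=> cf cg; exact: continuousD. Qed.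

Lemma continuous_expf f n x : {for x, continuous f} ->
  {for x, continuous (fun y => f y ^+ n)}.
Proof.
move=> cf; elim: n => [|n IH]; first exact: cst_continuous.
have -> : (fun y => f y ^+ n.+1) = (fun y => f y * f y ^+ n).
  by apply/funext => y; rewrite exprS.
exact: continuous_mulf.
Qed.

End pointwise_continuity.

Section has_grad.
Context {R : realType} {V : normedModType R}.

(** Pairs differentiability with a closed form for all directional derivatives at once, so that the
    product and chain rules compute second derivatives up to [ring]. *)
Definition has_grad (g : V -> R) (x : V) (G : V -> R) : Prop :=
  differentiable g x /\ forall v, 'D_v g x = G v.

Lemma has_grad_cst (c : R) x : has_grad (cst c) x (cst 0).
Proof. by split=> [|v]; [exact: differentiable_cst|rewrite derive_cst]. Qed.

Lemma has_gradD f g x F G : has_grad f x F -> has_grad g x G ->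
  has_grad (fun y => f y + g y) x (fun v => F v + G v).
Proof.
move=> [df fF] [dg gG]; split; first exact: differentiableD.
by move=> v; rewrite -fF -gG -deriveD//; exact: diff_derivable.
Qed.

Lemma has_gradN f x F : has_grad f x F ->
  has_grad (fun y => - f y) x (fun v => - F v).
Proof.
move=> [df fF]; split; first exact: differentiableN.
by move=> v; rewrite -fF -deriveN//; exact: diff_derivable.
Qed.

Lemma has_gradM f g x F G : has_grad f x F -> has_grad g x G ->
  has_grad (fun y => f y * g y) x (fun v => f x * G v + g x * F v).
Proof.
move=> [df fF] [dg gG]; split; first exact: differentiableM.
by move=> v; rewrite -fF -gG -[RHS]deriveM//; exact: diff_derivable.
Qed.

Lemma has_grad_sum n (f : 'I_n -> V -> R) x F :
  (forall i, has_grad (f i) x (F i)) ->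
  has_grad (fun y => \sum_(i < n) f i y) x (fun v => \sum_(i < n) F i v).
Proof.
move=> fF.
have -> : (fun y => \sum_(i < n) f i y) = \sum_(i < n) f i.
  by apply/funext => y; rewrite fct_sumE.
split; first by apply: differentiable_sum => i; case: (fF i).
move=> v; rewrite derive_sum; first by apply: eq_bigr => i _; case: (fF i).
by move=> i; apply: diff_derivable; case: (fF i).
Qed.

Lemma has_grad_chain g phi x G d : has_grad g x G -> is_derive (g x) 1 phi d ->
  has_grad (fun y => phi (g y)) x (fun v => d * G v).
Proof.
move=> [dg gG] dphi; have [dc dcE] := differentiable_chain dg dphi.
by split=> // v; rewrite -gG; exact: dcE.
Qed.

Lemma has_grad_near f g x G : (\near x, f x = g x) -> has_grad g x G ->
  has_grad f x G.
Proof.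
move=> fg [dg gG]; split; first exact: near_eq_differentiable dg.
by move=> v; rewrite -gG; exact: near_eq_derive.
Qed.

Lemma has_grad_cont f x F : has_grad f x F -> {for x, continuous f}.
Proof. by case=> df _; exact: differentiable_continuous. Qed.

End has_grad.

Section radial.
Context {R : realType} {N : nat}.
Notation V := 'rV[R]_N.+1.
Implicit Types x v w : V.

Definition dot x v : R := \sum_(i < N.+1) x 0 i * v 0 i.
Notation invn := (fun y : V => (enorm y)^-1).

Lemma enormE x : enorm x = Num.sqrt (dot x x).
Proof. by congr Num.sqrt; apply: eq_bigr => i _; rewrite expr2. Qed.

Lemma dot_gt0 x : x != 0 -> 0 < dot x x.
Proof.
move=> x0; rewrite lt0r; apply/andP; split; last first.
  by apply: sumr_ge0 => i _; rewrite -expr2 sqr_ge0.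
apply: contra x0 => /eqP/psumr_eq0P => h.
apply/eqP/rowP => i; rewrite mxE; apply/eqP.
by rewrite -sqrf_eq0 expr2 h// => j _; rewrite -expr2 sqr_ge0.
Qed.

Lemma has_grad_coord i x : has_grad (fun y : V => y 0 i) x (fun v => v 0 i).
Proof.
have @f : {linear V -> R}.
  by exists (fun y : V => y 0 i); do 2![eexists]; do ?[constructor];
     rewrite ?mxE// => ? *; rewrite ?mxE//; move=> ?; rewrite !mxE.
have dx := differentiable_coord x 0 i.
split=> // v; rewrite deriveE//; have -> : (fun y : V => y 0 i) = f by [].
by rewrite diff_lin//; exact: coord_continuous.
Qed.

Lemma enorm_gt0 x : x != 0 -> 0 < enorm x.
Proof. by move=> x0; rewrite enormE sqrtr_gt0 dot_gt0. Qed.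

Lemma coord_le_enorm x i : x 0 i <= enorm x.
Proof.
rewrite (le_trans (ler_norm _))// -sqrtr_sqr enormE ler_wsqrtr//.
rewrite /dot (bigD1 i)//= -expr2 lerDl sumr_ge0// => j _.
by rewrite -expr2 sqr_ge0.
Qed.

Lemma has_grad_dot v x : has_grad (fun y => dot y v) x (fun w => dot w v).
Proof.
apply: has_grad_sum => i.
have /= [h1 h2] := has_gradM (has_grad_coord i x) (has_grad_cst (v 0 i) x).
by split=> // w; rewrite h2 /= mulr0 add0r mulrC.
Qed.

Lemma has_grad_sq x : has_grad (fun y => dot y y) x (fun w => 2 * dot x w).
Proof.
have [h1 h2] := has_grad_sum (fun i => has_gradM (has_grad_coord i x) (has_grad_coord i x)).
split=> // w; rewrite h2 mulr_sumr; apply: eq_bigr => i _.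
by rewrite -mulr2n mulr_natl.
Qed.

Lemma is_derive_invsqrt (s : R) : 0 < s ->
  is_derive s 1 (fun r => (Num.sqrt r)^-1) (- 2^-1 * (Num.sqrt s)^-1 ^+ 3).
Proof.
move=> s0; have q0 : Num.sqrt s != 0 by rewrite gt_eqF// sqrtr_gt0.
have h : is_derive s 1 Num.sqrt (2 * Num.sqrt s)^-1 by exact: is_derive1_sqrt.
apply: DeriveDef; first by apply: derivableV.
rewrite deriveV// derive_val -[_ *: _]/(_ * _).
by field.
Qed.

Lemma has_grad_inv_enorm x : x != 0 ->
  has_grad invn x (fun v => - invn x ^+ 3 * dot x v).
Proof.
move=> x0.
have [h1 h2] := has_grad_chain (has_grad_sq x) (is_derive_invsqrt (dot_gt0 x0)).
have E : (fun y => (Num.sqrt (dot y y))^-1) = invn.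
  by apply/funext => y; rewrite enormE.
rewrite E in h1 h2; split => // v; rewrite h2 enormE.
by field; rewrite -enormE gt_eqF ?enorm_gt0.
Qed.

(** The height [t = 1 - x_{N+1}] extended homogeneously of degree 0, which is what [hext] does to a
    function of [t]. *)
Definition zeta x : R := 1 - invn x * x 0 ord_max.
Definition dzeta x v : R :=
  invn x ^+ 3 * dot x v * x 0 ord_max - invn x * v 0 ord_max.
Definition ddzeta x v w : R :=
  - 3 * invn x ^+ 5 * dot x w * dot x v * x 0 ord_max
  + invn x ^+ 3 * dot w v * x 0 ord_max
  + invn x ^+ 3 * dot x v * w 0 ord_max
  + invn x ^+ 3 * dot x w * v 0 ord_max.

Lemma has_grad_zeta x : x != 0 -> has_grad zeta x (dzeta x).
Proof.
move=> x0.
have [h1 h2] := has_gradD (has_grad_cst (1 : R) x) (has_gradN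
  (has_gradM (has_grad_inv_enorm x0) (has_grad_coord ord_max x))).
by split=> // v; rewrite h2 /dzeta/=; ring.
Qed.

Lemma has_grad_dzeta v x : x != 0 ->
  has_grad (fun y => dzeta y v) x (ddzeta x v).
Proof.
move=> x0; have hm := has_grad_inv_enorm x0.
have hx := has_grad_coord ord_max x.
have [h1 h2] := has_gradD (has_gradM (has_gradM (has_gradM hm (has_gradM hm hm))
    (has_grad_dot v x)) hx)
  (has_gradN (has_gradM hm (has_grad_cst (v 0 ord_max) x))).
have E : (fun y : V => dzeta y v) = (fun y => invn y * (invn y * invn y) *
   dot y v * y 0 ord_max + - (invn y * cst (v 0 ord_max) y)).
  by apply/funext => y; rewrite /dzeta/= !exprS expr0 mulr1.
rewrite E; split=> // w; rewrite h2 /ddzeta/=; ring.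
Qed.

Lemma zeta_ge0 x : 0 <= zeta x.
Proof.
rewrite subr_ge0; have [->|x0] := eqVneq x 0; first by rewrite mxE mulr0.
by rewrite mulrC ler_pdivrMr ?enorm_gt0// mul1r coord_le_enorm.
Qed.

Lemma near_cone (T : R) x : x != 0 -> zeta x < T ->
  \near x, x != 0 /\ zeta x < T.
Proof.
move=> x0 xT.
have c1 := has_grad_cont (has_grad_zeta x0).
have c2 := has_grad_cont (has_grad_sq x).
have n1 : \near x, zeta x < T by exact: (cvgr_lt _ c1 _ xT).
have n2 : \near x, 0 < dot x x by exact: (cvgr_gt _ c2 _ (dot_gt0 x0)).
apply: filterS2 n1 n2 => y yT y0; split => //.
apply: contraTneq y0 => ->.
by rewrite /dot big1 ?ltxx// => i _; rewrite mxE mul0r.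
Qed.

Section profile.
Variables (T : R) (phi phi1 phi2 : R -> R).
Hypothesis d1 : forall t, 0 <= t < T -> is_derive t 1 phi (phi1 t).
Hypothesis d2 : forall t, 0 <= t < T -> is_derive t 1 phi1 (phi2 t).
Hypothesis c2 : forall t, 0 <= t < T -> {for t, continuous phi2}.

Let U : set V := [set x | x != 0 /\ zeta x < T].

Let h := fun x => phi (zeta x).

(** At the pole [zeta x = 0], and the chain rule asks for a two-sided derivative of [phi] there
    although [zeta] is never negative. This is why every profile is later extended to [t < 0]. *)
Lemma has_grad_radial x : U x -> has_grad h x (fun v => phi1 (zeta x) * dzeta x v).
Proof.
move=> [x0 xT]; apply: has_grad_chain (has_grad_zeta x0) (d1 _).
by rewrite zeta_ge0.
Qed.

Let near_U x : U x -> \near x, U x.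
Proof. by case=> x0 xT; exact: near_cone. Qed.

Lemma has_grad2_radial v x : U x -> has_grad (fun y => 'D_v h y) x
  (fun w => phi2 (zeta x) * dzeta x w * dzeta x v + phi1 (zeta x) * ddzeta x v w).
Proof.
move=> xU; have [x0 xT] := xU.
apply: (@has_grad_near _ _ _ (fun y => phi1 (zeta y) * dzeta y v)).
  by apply: filterS (near_U xU) => y /has_grad_radial[_ ->].
have dp : is_derive (zeta x) 1 phi1 (phi2 (zeta x)) by apply: d2; rewrite zeta_ge0.
have [k1 k2] := has_gradM (has_grad_chain (has_grad_zeta x0) dp) (has_grad_dzeta v x0).
by split=> // w; rewrite k2; ring.
Qed.

Lemma continuous_ddzeta v w x : x != 0 ->
  {for x, continuous (fun y => ddzeta y v w)}.
Proof.
move=> x0; have cm := has_grad_cont (has_grad_inv_enorm x0).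
have cx := has_grad_cont (has_grad_coord ord_max x).
have cd u := has_grad_cont (has_grad_dot u x).
have cc (c : R) : {for x, continuous (fun _ : V => c)} by exact: cst_continuous.
have cX n := @continuous_expf _ _ _ n _ cm.
by rewrite /ddzeta; do !(apply: continuous_addf || apply: continuous_mulf).
Qed.

Lemma continuous2_radial v w x : U x ->
  {for x, continuous (fun y => 'D_w (fun z => 'D_v h z) y)}.
Proof.
move=> xU; have [x0 xT] := xU.
pose g y := phi2 (zeta y) * dzeta y w * dzeta y v + phi1 (zeta y) * ddzeta y v w.
have gE : \near x, g x = 'D_w (fun z => 'D_v h z) x.
  by apply: filterS (near_U xU) => y /(has_grad2_radial v)[_ ->].
have cg : {for x, continuous g}; last first.
  rewrite /prop_for /continuous_at /= -(nbhs_singleton gE); apply: cvg_trans (near_eq_cvg gE) _. exact: cg.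
have cz := has_grad_cont (has_grad_zeta x0).
have cdz u := has_grad_cont (has_grad_dzeta u x0).
have zT : 0 <= zeta x < T by rewrite zeta_ge0.
apply: continuous_addf; apply: continuous_mulf => //.
- by apply: continuous_mulf => //; apply: continuous_comp => //; exact: c2.
- apply: continuous_comp => //; apply/differentiable_continuous/derivable1_diffP.
  by have [] := d2 zT.
- exact: continuous_ddzeta.
Qed.

Lemma sphere_neq0 x : sphere x -> x != 0.
Proof.
move=> sx; apply/eqP => x0; move: sx; rewrite /sphere/= x0 big1 => [/eqP|i _].
  by rewrite eq_sym oner_eq0.
by rewrite mxE expr0n.
Qed.

Lemma sphere_enorm x : sphere x -> enorm x = 1.
Proof. by move=> sx; rewrite /enorm sx sqrtr1. Qed.

Lemma sphere_zeta x : sphere x -> zeta x = 1 - x 0 ord_max.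
Proof. by move=> sx; rewrite /zeta sphere_enorm// invr1 mul1r. Qed.

Let hE : hext (fun x => phi (1 - x 0 ord_max)) = h.
Proof. by apply/funext => x; rewrite /hext /h /zeta mxE. Qed.

Lemma C2_near_radial (A : set V) :
  (forall x, A x -> sphere x /\ 1 - x 0 ord_max < T) ->
  C2_near (hext (fun x => phi (1 - x 0 ord_max))) A.
Proof.
move=> AT; rewrite hE; exists U; split; [|split].
- by rewrite openE => x xU; apply: near_U.
- by move=> x /AT[sx xT]; split; [exact: sphere_neq0|rewrite sphere_zeta].
- move=> x xU; split; [|split].
  + by case: (has_grad_radial xU).
  + by move=> v; case: (has_grad2_radial v xU).
  + by move=> v w; exact: continuous2_radial.
Qed.

(** On the sphere the squares of the partial derivatives of [zeta] add up to
    [1 - x_{N+1}^2 = t(2-t)], and its pure second derivatives add up to [N x_{N+1} = N(1-t)]. *)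
Lemma lapS_radial x : sphere x -> 1 - x 0 ord_max < T ->
  let t := 1 - x 0 ord_max in
  lapS (fun x => phi (1 - x 0 ord_max)) x =
  t * (2 - t) * phi2 t + N%:R * (1 - t) * phi1 t.
Proof.
move=> sx xT t; have xU : U x.
  by split; [exact: sphere_neq0|rewrite sphere_zeta].
rewrite /lapS /lapl hE.
have sqx : \sum_(i < N.+1) x 0 i ^+ 2 = 1 by [].
have dotE i : dot x (evec R i) = x 0 i.
  rewrite /dot (bigD1 i)//= mxE !eqxx mulr1 big1 ?addr0// => j ji.
  by rewrite mxE eqxx/= (negbTE ji) mulr0.
have dotee i : dot (evec R i) (evec R i : V) = 1.
  by rewrite /dot (bigD1 i)//= !mxE !eqxx mulr1 big1 ?addr0// => j ji;
    rewrite !mxE eqxx/= (negbTE ji) mulr0.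
under eq_bigr => i _.
  have [_ ->] := has_grad2_radial (evec R i) xU.
  rewrite /dzeta /ddzeta dotE dotee sphere_zeta// sphere_enorm// invr1 !expr1n.
  over.
rewrite -/t; pose a : R := x 0 ord_max; pose d (i : 'I_N.+1) : R := evec R i 0 ord_max.
have dsum (y : 'I_N.+1 -> R) : \sum_i y i * d i = y ord_max.
  rewrite (bigD1 ord_max)//= /d mxE !eqxx mulr1 big1 ?addr0// => i im.
  by rewrite mxE eqxx/= eq_sym (negbTE im) mulr0.
have d1' : d ord_max = 1 by rewrite /d mxE !eqxx.
transitivity (\sum_(i < N.+1) ((phi2 t * a ^+ 2 - 3 * a * phi1 t) * x 0 i ^+ 2 +
    (2 * phi1 t - 2 * a * phi2 t) * (x 0 i * d i) + phi2 t * (d i * d i) +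
    phi1 t * a)).
  by apply: eq_bigr => i _; rewrite /a /d; ring.
rewrite !big_split/= -!mulr_sumr sqx !dsum d1' sumr_const card_ord -/a.
rewrite -mulr_natr -natr1 (_ : a = 1 - t); first by ring.
by rewrite /t opprB addrC subrK.
Qed.

End profile.
End radial.

(** * Comparison of eigenvalues with supersolutions *)

Section second_derivative_test.
Context {R : realType}.

(** If [k2 > 0], then [k1], which vanishes at 0, is positive just to the right of 0, and the mean
    value theorem makes [k] exceed [k 0] there. *)
Lemma snd_derive_le0_at_max (k k1 : R -> R) (k2 e : R) : 0 < e ->
  (forall s : R, `|s| < e -> is_derive s 1 k (k1 s)) ->
  is_derive (0 : R) 1 k1 k2 ->
  (forall s : R, `|s| < e -> k s <= k 0) -> k2 <= 0.
Proof.
move=> e0 dk dk1 kmax; rewrite leNgt; apply/negP => k20.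
have n0 : `|0 : R| < e by rewrite normr0.
have ine s : s \in `]-e, e[ -> `|s| < e by rewrite in_itv/= ltr_norml.
have k10 : k1 0 = 0.
  have h : is_derive (0 : R) 1 k 0.
    apply: (@derive1_at_max R k (-e) e).
    - lra.
    - by move=> t /ine /dk[].
    - by rewrite in_itv/=; apply/andP; split; lra.
    - by move=> t /ine; exact: kmax.
  by have [_ <-] := dk _ n0; case: h.
have [d d0 k1gt] : exists2 d : R, 0 < d & forall s, 0 < s < d -> 0 < k1 s.
  have [dk1' dk1E] := dk1.
  have cv : (fun h : R => h^-1 *: ((k1 \o shift 0) (h *: 1) - k1 0)) @ 0^' --> k2.
    by rewrite -dk1E; exact: dk1'.
  have : nbhs (0 : R) (fun h => h != 0 ->
    0 < h^-1 *: ((k1 \o shift 0) (h *: 1) - k1 0)) by exact: (cvgr_gt _ cv _ k20).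
  move=> /nbhs_ballP[d /= d0 dP].
  exists d => // s /andP[s0 sd].
  have := dP s; rewrite /ball/= sub0r normrN gtr0_norm// gt_eqF// => /(_ sd isT).
  by rewrite k10 subr0 addr0 [s *: 1]mulr1 -[_ *: _]/(_ * _) pmulr_rgt0// invr_gt0.
pose m := Num.min d e / 2.
have m0 : 0 < m by rewrite divr_gt0// lt_min d0 e0.
have md : m < Num.min d e by rewrite /m ltr_pdivrMr// ltr_pMr ?ltr1n// lt_min d0 e0.
have [md' me] : m < d /\ m < e by move: md; rewrite lt_min => /andP.
have inm s : 0 <= s <= m -> `|s| < e.
  by move=> /andP[s0 sm]; rewrite ger0_norm// (le_lt_trans sm).
have [s|s|c cm kE] := @MVT R k k1 0 m m0.
- by rewrite in_itv/= => /andP[/ltW s0 /ltW sm]; apply: dk; apply: inm; rewrite s0.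
- apply: continuous_in_subspaceT => y; rewrite inE/= in_itv/= => ym.
  by apply/differentiable_continuous/derivable1_diffP; have [] := dk _ (inm _ ym).
have : k m - k 0 <= 0 by rewrite subr_le0 kmax// inm// lexx ltW.
rewrite kE subr0 leNgt mulr_gt0// k1gt//.
by move: cm; rewrite in_itv/= => /andP[-> cm]; rewrite (lt_trans cm).
Qed.

Lemma is_derive_line (V : normedModType R) (h : V -> R) (x v : V) (s : R) :
  derivable h (s *: v + x) v ->
  is_derive s 1 (fun r => h (r *: v + x)) ('D_v h (s *: v + x)).
Proof.
move=> dh.
have E : (fun r : R => r^-1 *: (((fun r => h (r *: v + x)) \o shift s) (r *: 1) - h (s *: v + x)))
   = (fun r : R => r^-1 *: ((h \o shift (s *: v + x)) (r *: v) - h (s *: v + x))).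
  by apply/funext => r /=; rewrite [r *: 1]mulr1 scalerDl addrA.
by apply: DeriveDef; rewrite /derivable /derive E.
Qed.

Lemma near_line (V : normedModType R) (P : set V) (x v : V) : nbhs x P ->
  exists2 e : R, 0 < e & forall s : R, `|s| < e -> P (s *: v + x).
Proof.
move=> xP.
have c : (fun s : R => s *: v + x) @ (0 : R) --> (0 : R) *: v + x.
  exact: (@cvgD _ _ _ _ _ (fun s : R => s *: v) (cst x) _ _ (@scalel_continuous R V v 0) (cvg_cst x)).
rewrite scale0r add0r in c.
have /nbhs_ballP[e /= e0 eP] := c _ xP.
by exists e => // s se; apply: eP; rewrite /ball/= sub0r normrN.
Qed.

Lemma derive2_le (V : normedModType R) (h1 h2 : V -> R) (x v : V) :
  (\near x, derivable h1 x v) -> (\near x, derivable h2 x v) ->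
  derivable (fun y => 'D_v h1 y) x v -> derivable (fun y => 'D_v h2 y) x v ->
  (\near x, h1 x <= h2 x) -> h1 x = h2 x ->
  'D_v (fun y => 'D_v h1 y) x <= 'D_v (fun y => 'D_v h2 y) x.
Proof.
move=> n1 n2 dd1 dd2 n12 h12; rewrite -subr_le0.
have n : \near x, [/\ derivable h1 x v, derivable h2 x v & h1 x <= h2 x].
  by apply: filterS3 n1 n2 n12 => y; split.
have [e e0 eP] := near_line v n.
pose k (s : R) := h1 (s *: v + x) - h2 (s *: v + x).
pose k1 (s : R) := 'D_v h1 (s *: v + x) - 'D_v h2 (s *: v + x).
pose k2 : R := 'D_v (fun y => 'D_v h1 y) x - 'D_v (fun y => 'D_v h2 y) x.
have := @snd_derive_le0_at_max k k1 k2 e e0; apply.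
- move=> s /eP[d1 d2 _].
  exact: (is_deriveB (is_derive_line d1) (is_derive_line d2)).
- have E : 0 *: v + x = x by rewrite scale0r add0r.
  have l1 : derivable (fun y => 'D_v h1 y) (0 *: v + x) v by rewrite E.
  have l2 : derivable (fun y => 'D_v h2 y) (0 *: v + x) v by rewrite E.
  have := is_deriveB (is_derive_line l1) (is_derive_line l2).
  by rewrite E; exact.
- move=> s /eP[_ _]; rewrite /k scale0r add0r h12 subrr subr_le0//.
Qed.

End second_derivative_test.

Section barta.
Context {R : realType} {N : nat}.
Notation V := 'rV[R]_N.+1.
Implicit Types (x : V) (u : V -> R).

Lemma lapl_le (h1 h2 : V -> R) (A : set V) x : A x -> C2_near h1 A -> C2_near h2 A ->
  (\near x, h1 x <= h2 x) -> h1 x = h2 x -> lapl h1 x <= lapl h2 x.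
Proof.
move=> Ax [U1 [oU1 [AU1 hU1]]] [U2 [oU2 [AU2 hU2]]] n12 h12.
apply: ler_sum => i _.
have n1 : \near x, U1 x by apply: open_nbhs_nbhs; split => //; exact: AU1.
have n2 : \near x, U2 x by apply: open_nbhs_nbhs; split => //; exact: AU2.
apply: derive2_le => //.
- by apply: filterS n1 => y /hU1[d _]; exact: diff_derivable.
- by apply: filterS n2 => y /hU2[d _]; exact: diff_derivable.
- by apply: diff_derivable; have [_ []] := hU1 _ (AU1 _ Ax).
- by apply: diff_derivable; have [_ []] := hU2 _ (AU2 _ Ax).
Qed.

Lemma C2_near_lin (a b : R) (h : V -> R) (A : set V) :
  C2_near h A -> C2_near (fun x => a * h x + b) A.
Proof.
move=> [U [oU [AU hU]]]; exists U.
split; [exact: oU|split; [exact: AU|move=> x Ux]].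
have g1 y : U y -> has_grad (fun x => a * h x + b) y (fun v => a * 'D_v h y).
  move=> /hU[d _].
  have hd : has_grad h y (fun v => 'D_v h y) by [].
  have [k1 k2] := has_gradD (has_gradM (has_grad_cst a y) hd) (has_grad_cst b y).
  by split => // v; rewrite k2 /= mulr0 !addr0.
have nU y : U y -> \near y, U y by move=> Uy; apply: open_nbhs_nbhs.
have g2 v y : U y -> has_grad (fun y => 'D_v (fun x => a * h x + b) y) y
    (fun w => a * 'D_w (fun y => 'D_v h y) y).
  move=> Uy; apply: (@has_grad_near _ _ _ (fun y => a * 'D_v h y)).
    by apply: filterS (nU _ Uy) => z /g1[_ ->].
  have [_ [/(_ v) d _]] := hU _ Uy.
  have hd : has_grad (fun y => 'D_v h y) y (fun w => 'D_w (fun y => 'D_v h y) y) by [].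
  have [k1 k2] := has_gradM (has_grad_cst a y) hd.
  by split => // w; rewrite k2 /= mulr0 addr0.
split; [|split].
- by have [] := g1 _ Ux.
- by move=> v; have [] := g2 v _ Ux.
- move=> v w.
  have [_ [_ /(_ v w) c]] := hU _ Ux.
  pose g y := a * 'D_w (fun y => 'D_v h y) y.
  have cg : {for x, continuous g} by apply: continuous_mulf => //; exact: cst_continuous.
  have gE : \near x, g x = 'D_w (fun y => 'D_v (fun x => a * h x + b) y) x.
    by apply: filterS (nU _ Ux) => y /(g2 v)[_ ->].
  rewrite /prop_for /continuous_at /= -(nbhs_singleton gE).
  by apply: cvg_trans (near_eq_cvg gE) _; exact: cg.
Qed.

Lemma lapl_lin (a b : R) (h : V -> R) (A : set V) x : C2_near h A -> A x ->
  lapl (fun x => a * h x + b) x = a * lapl h x.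
Proof.
move=> [U [oU [AU hU]]] /AU Ux; rewrite mulr_sumr; apply: eq_bigr => i _.
have nU : \near x, U x by apply: open_nbhs_nbhs.
have [_ [/(_ (evec R i)) d _]] := hU _ Ux.
have hd : has_grad (fun y => 'D_(evec R i) h y) x
   (fun w => 'D_w (fun y => 'D_(evec R i) h y) x) by [].
have [_ k2] := has_gradM (has_grad_cst a x) hd.
transitivity ('D_(evec R i) (fun y => cst a y * 'D_(evec R i) h y) x); last first.
  by rewrite k2 /= mulr0 addr0.
apply: near_eq_derive; apply: filterS nU => y /hU[{}d _].
have {}hd : has_grad h y (fun v => 'D_v h y) by [].
have [_ ->] := has_gradD (has_gradM (has_grad_cst a y) hd) (has_grad_cst b y).
by rewrite /= mulr0 !addr0.
Qed.

Lemma sphere_dot x : sphere x <-> dot x x = 1.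
Proof.
rewrite /sphere /dot /=.
by have -> : \sum_i x 0 i ^+ 2 = \sum_i x 0 i * x 0 i
  by apply: eq_bigr => i _; rewrite expr2.
Qed.

Lemma sphere_normalize x : x != 0 -> sphere ((enorm x)^-1 *: x).
Proof.
move=> x0; apply/sphere_dot.
have -> : dot ((enorm x)^-1 *: x) ((enorm x)^-1 *: x) = (enorm x)^-1 ^+ 2 * dot x x.
  by rewrite /dot mulr_sumr; apply: eq_bigr => i _; rewrite !mxE; ring.
by rewrite exprVn enormE sqr_sqrtr ?ltW ?dot_gt0// mulVf// gt_eqF// dot_gt0.
Qed.

Lemma sphere_coord_le1 x i : sphere x -> x 0 i <= 1.
Proof. by move=> /sphere_enorm <-; exact: coord_le_enorm. Qed.

Lemma cap_clP (eps : R) x :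
  cap_cl eps x <-> sphere x /\ cos ((1 - eps) * pi) <= x 0 ord_max.
Proof.
split=> [[[sx /andP[/ltW]]|[sx ->]]//|[sx]].
rewrite le_eqVlt => /predU1P[xE|xc]; first by right.
by left; split => //; rewrite xc sphere_coord_le1.
Qed.

Lemma compact_cap_cl (eps : R) : compact (@cap_cl R N eps).
Proof.
apply: bounded_closed_compact.
  exists 1; split; first exact: num_real.
  move=> M M1 x /cap_clP[sx _] /=.
  have -> : `|x| = mx_norm x by [].
  rewrite mx_normrE.
  apply: bigmax_le => [|[i j] _]; first by rewrite (le_trans _ (ltW M1)).
  rewrite (le_trans _ (ltW M1))// ord1/= -(sphere_enorm sx) -sqrtr_sqr enormE.
  rewrite ler_wsqrtr// /dot (bigD1 j)//= -expr2 lerDl sumr_ge0// => k _.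
  by rewrite -expr2 sqr_ge0.
have -> : @cap_cl R N eps = [set x : V | dot x x = 1] `&`
    [set x : V | cos ((1 - eps) * pi) <= x 0 ord_max].
  apply/seteqP; split=> x; first by move=> /cap_clP[/sphere_dot].
  by move=> [/sphere_dot sx xc]; apply/cap_clP.
apply: closedI.
- have -> : [set x : V | dot x x = 1] = (fun x => dot x x) @^-1` [set 1] by [].
  apply: closed_comp => [x _|]; last exact: closed_eq.
  exact: (has_grad_cont (has_grad_sq x)).
- apply: (@closed_comp _ _ (fun x : V => x 0 ord_max) [set y | _ <= y]).
    by move=> x _; exact: (has_grad_cont (has_grad_coord ord_max x)).
  exact: closed_ge.
Qed.

Lemma hext_sphere u x : sphere x -> hext u x = u x.
Proof. by move=> /sphere_enorm x1; rewrite /hext x1 invr1 scale1r. Qed.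

(** As [hext] is constant on rays, an inequality on the cap becomes one on a full neighbourhood in
    R^{N+1}, where the Laplacian can be compared direction by direction. *)
Lemma near_cap (eps : R) x : cap eps x ->
  \near x, cap eps ((enorm x)^-1 *: x).
Proof.
move=> [sx /andP[xc _]].
have : zeta x < 1 - cos ((1 - eps) * pi) by rewrite sphere_zeta// ltrD2l ltrN2.
move=> /(near_cone (sphere_neq0 sx)); apply: filterS => y [y0 yc].
have sy := sphere_normalize y0.
split; first exact: sy.
rewrite sphere_coord_le1// andbT.
by move: yc; rewrite /zeta ltrD2l ltrN2 mxE.
Qed.

(* At an interior maximum point of [v / W], where [v] is an eigenfunction, the
   Laplacian of [v - (v / W)(x) W] is nonpositive. *)
Lemma barta (eps nu mu : R) (W : V -> R) :
  C2_near (hext W) (cap eps) -> {within cap_cl eps, continuous W} ->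
  (forall x, cap_cl eps x -> 0 < W x) ->
  (forall x, cap eps x -> nu * W x < - lapS W x) ->
  dir_eigenvalue N eps mu -> nu < mu.
Proof.
move=> CW cW W0 LW [v0 [[Cv0 [cv0 bv0]] [[z [zc vz0]] Lv0]]].
(* Replacing [v0] by its opposite if necessary makes the maximum of [v / W] positive, hence not
   attained on the boundary. *)
have [v [[Cv [cv bv]] vz Lv]] : exists v, [/\ classical_dirichlet eps v,
    0 < v z & forall x, cap eps x -> - lapS v x = mu * v x].
  have [vz|vz] := ltP 0 (v0 z); first by exists v0.
  exists (fun x => - v0 x); have E : hext (fun x => - v0 x) = (fun x => -1 * hext v0 x + 0).
    by apply/funext => x; rewrite /hext addr0 mulN1r.
  split.
  - split; first by rewrite E; exact: C2_near_lin.
    split; first by move=> x; apply: continuousN; exact: cv0.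
    by move=> x /bv0 ->; rewrite oppr0.
  - by rewrite oppr_gt0 lt_neqAle vz0.
  - move=> x xc; rewrite /lapS E (lapl_lin _ _ Cv0)// mulN1r -[lapl _ _]/(lapS v0 x).
    by rewrite Lv0// mulrN.
have zcl : cap_cl eps z by left.
have cr : {within cap_cl eps, continuous (fun x => v x * (W x)^-1)}.
  rewrite continuous_subspace_in => x; rewrite inE => xA.
  apply: cvgM; first exact: cv.
  by apply: cvgV; [rewrite gt_eqF// W0|exact: cW].
have [c] := EVT_max_rV (ex_intro _ z zcl) (@compact_cap_cl eps) cr.
rewrite inE => ccl cmax; pose t := v c * (W c)^-1.
have t0 : 0 < t.
  by apply: lt_le_trans (cmax z _); rewrite ?inE// divr_gt0// W0.
have cc : cap eps c.
  case: ccl => // /bv vc0; move: t0; rewrite /t vc0 mul0r ltxx//.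
have vE : v c = t * W c by rewrite /t divfK// gt_eqF// W0.
have le1 x : cap_cl eps x -> v x <= t * W x.
  by move=> xA; rewrite -ler_pdivrMr ?W0//; apply: cmax; rewrite inE.
have sc : sphere c by case: cc.
have : lapl (hext v) c <= lapl (fun x => t * hext W x + 0) c.
  apply: (lapl_le cc Cv (C2_near_lin t 0 CW)).
    by apply: filterS (near_cap cc) => y yc; rewrite addr0; apply: le1; left.
  by rewrite addr0 !hext_sphere.
rewrite (lapl_lin _ _ CW)// -[lapl _ c]/(lapS v c) -[lapl _ c]/(lapS W c) => lap.
have vc0 : 0 < v c by rewrite vE mulr_gt0// W0.
(* At [c], where [v] touches [t W] from below, [mu v = - Delta v >= - t Delta W > t nu W = nu v],
   and [v c > 0]. *)
rewrite -(ltr_pM2r vc0) -Lv//.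
rewrite (@lt_le_trans _ _ (t * - lapS W c))//; last by rewrite mulrN lerN2.
by rewrite {1}vE mulrCA ltr_pM2l// LW.
Qed.

End barta.

(** * The hypergeometric solution and the torsion function *)

Section power_series.
Context {R : realType}.
Implicit Types (c : R^nat) (t r : R).

Notation psum c t := (limn (pseries c t)).

(** Radius of convergence at least 2, the distance from the pole to the other singular point
    [t = 2]. The ratio condition is written as a product so that zero coefficients are allowed. *)
Definition radius2 c := forall r, 2^-1 < r ->
  exists k0 : nat, forall k, (k0 <= k)%N -> `|c k.+1| <= r * `|c k|.

Lemma radius2_bound c r : radius2 c -> 2^-1 < r ->
  exists C, forall k, `|c k| <= C * r ^+ k.
Proof.
move=> rc r2; have r0 : 0 < r by apply: lt_trans r2; rewrite invr_gt0.
have [k0 k0P] := rc _ r2.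
exists (\sum_(i < k0.+1) `|c i| / r ^+ i) => k.
have small j : (j <= k0)%N -> `|c j| <= (\sum_(i < k0.+1) `|c i| / r ^+ i) * r ^+ j.
  move=> jk; rewrite -ler_pdivrMr ?exprn_gt0//.
  rewrite (bigD1 (inord j))//= inordK// lerDl sumr_ge0// => i _.
  by rewrite divr_ge0// exprn_ge0// ltW.
elim: k => [|k IH]; first exact: small.
have [kk|kk] := leqP k.+1 k0; first exact: small.
rewrite (le_trans (k0P _ _))// exprS mulrCA ler_pM2l//.
Qed.

Lemma radius2_cvg c t : radius2 c -> `|t| < 2 -> cvgn (pseries c t).
Proof.
move=> rc t2.
have t0 : 0 <= `|t| by [].
(* A ratio strictly above 1/2 whose product with [|t|] stays below 1; both hold exactly because
   [|t| < 2]. *)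
have r2 : 2^-1 < 2 / (2 + `|t|) by rewrite ltr_pdivlMr; lra.
have [C cC] := radius2_bound rc r2.
pose q := 2 / (2 + `|t|) * `|t|.
have q0 : 0 <= q by rewrite mulr_ge0// divr_ge0; lra.
have q1 : `|q| < 1 by rewrite ger0_norm// /q mulrAC ltr_pdivrMr; lra.
apply: normed_cvg.
apply: (@series_le_cvg _ _ (geometric C q)).
- by move=> k; exact: normr_ge0.
- move=> k /=; rewrite mulr_ge0 ?exprn_ge0//.
  by have := cC 0%N; rewrite expr0 mulr1; exact: le_trans.
- move=> k /=; rewrite normrM normrX /q exprMn mulrA.
  by rewrite ler_wpM2r ?exprn_ge0.
exact: is_cvg_geometric_series.
Qed.

(** Differentiation multiplies the ratio by [(k+2)/(k+1)], which is absorbed for large [k] by the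
    gap between [r'] and [r]. *)
Lemma radius2_diffs c : radius2 c -> radius2 (pseries_diffs c).
Proof.
move=> rc r r2.
have [r' r'2 r'r] : exists2 r', 2^-1 < r' & r' < r.
  by exists ((r + 2^-1) / 2); lra.
have [k0 k0P] := rc _ r'2.
have [m mP] : exists m : nat, r' / (r - r') < m%:R.
  exists (Num.bound (r' / (r - r'))); apply: archi_boundP.
  by rewrite divr_ge0//; lra.
exists (maxn k0 m) => k; rewrite geq_max => /andP[k0k mk].
rewrite /pseries_diffs !normrM !normr_nat.
have km : r' / (r - r') <= k%:R by rewrite (le_trans (ltW mP))// ler_nat.
rewrite ler_pdivrMr in km; last lra.
have h := k0P k.+1 (leqW k0k).
apply: (@le_trans _ _ (k.+2%:R * (r' * `|c k.+1|))).
  by rewrite ler_pM2l// ltr0n.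
rewrite !mulrA ler_wpM2r//.
have k2E : k.+2%:R = k%:R + 2 :> R by rewrite -addn2 natrD.
have k1E : k.+1%:R = k%:R + 1 :> R by rewrite -natr1.
by rewrite k2E k1E; nra.
Qed.

Lemma psum_shift c t s : pseries c t @ \oo --> s ->
  pseries (fun k => if k is j.+1 then c j else 0) t @ \oo --> t * s.
Proof.
move=> cs; rewrite -cvg_shiftS /=.
have -> : (fun n => pseries (fun k => if k is j.+1 then c j else 0) t n.+1) =
    (fun n => t * pseries c t n).
  apply/funext => n; rewrite /pseries /series /= big_nat_recl//= mul0r add0r mulr_sumr.
  by apply: eq_bigr => i _; rewrite exprS mulrCA.
exact: cvgMr.
Qed.

Lemma is_derive_psum c t : radius2 c -> `|t| < 2 ->
  is_derive t 1 (fun x => psum c x) (psum (pseries_diffs c) t).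
Proof.
move=> rc t2; pose K : R := (`|t| + 2) / 2.
have K2 : `|K| < 2 by rewrite ger0_norm; rewrite /K; have := normr_ge0 t; lra.
have tK : `|t| < `|K| by rewrite [ltRHS]ger0_norm; rewrite /K; have := normr_ge0 t; lra.
have rc1 := radius2_diffs rc; have rc2 := radius2_diffs rc1.
exact: (pseries_snd_diffs (radius2_cvg rc K2) (radius2_cvg rc1 K2) (radius2_cvg rc2 K2) tK).
Qed.

Lemma psum0 c : psum c 0 = c 0%N.
Proof.
apply/cvg_lim => //; rewrite -cvg_shiftS /=; apply: cvg_near_cst; apply: nearW => n.
rewrite /pseries /series /= big_nat_recl// expr0 mulr1 big1 ?addr0// => i _.
by rewrite expr0n mulr0.
Qed.

Lemma psum_ge_partial c t n : (forall k, 0 <= c k) -> 0 <= t ->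
  cvgn (pseries c t) -> pseries c t n <= psum c t.
Proof.
move=> c0 t0 ct; apply: nondecreasing_cvgn_le => //.
apply/nondecreasing_seqP => k; rewrite /pseries /series/= big_nat_recr//= lerDl.
by rewrite mulr_ge0// exprn_ge0.
Qed.

End power_series.

Section hypergeometric.
Context {R : realType} (N : nat).
Hypothesis N2 : (2 <= N)%N.
Notation psum c t := (limn (pseries c t)).
Implicit Types l m t : R.

Let N2' : 2 <= N%:R :> R. Proof. by rewrite ler_nat. Qed.

(* [1 - l * \sum_k hcoef l k * t ^ k] is the hypergeometric solution, regular at
   [t = 0], of [t(2-t)w'' + N(1-t)w' + l w = 0]. *)
Fixpoint hcoef l (k : nat) : R :=
  if k is j.+1 then
    if j is 0 then N%:R^-1
    else (j%:R * (j%:R + N%:R - 1) - l) / (j.+1%:R * (2 * j%:R + N%:R)) * hcoef l j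
  else 0.

Lemma hcoefS l k : hcoef l k.+1 * (k.+1%:R * (2 * k%:R + N%:R)) =
  (k == 0%N)%:R + (k%:R * (k%:R + N%:R - 1) - l) * hcoef l k.
Proof.
have n2 := N2'.
case: k => [|k] /=.
  by rewrite !mulr0 addr0 add0r mul1r mulVf// gt_eqF//; lra.
rewrite add0r mulrAC divfK// gt_eqF// mulr_gt0//.
Qed.

Lemma hcoef_ratio_ge0 l k : 0 <= l <= 1 ->
  0 <= (k.+1%:R * (k.+1%:R + N%:R - 1) - l) / (k.+2%:R * (2 * k.+1%:R + N%:R)).
Proof.
have n2 := N2'.
move=> /andP[l0 l1]; have k1 : 1 <= k.+1%:R :> R by rewrite ler1n.
apply: divr_ge0; last by rewrite mulr_ge0//; lra.
by rewrite subr_ge0 (le_trans l1)// mulr_ege1//; lra.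
Qed.

Lemma hcoef_ge0 l k : 0 <= l <= 1 -> 0 <= hcoef l k.
Proof.
have n2 := N2'.
move=> l01; elim: k => [|[|k] IH]//=.
by apply: mulr_ge0 => //; exact: hcoef_ratio_ge0.
Qed.

(** The factor [1 - 1/(k+1)] makes the induction close. With [x = k+1], one step of the recurrence
    adds a relative error [1/a], where [a = x(x+N-1)]. Since [N >= 2],
    [1/a <= 1/(x(x+1)) = 1/x - 1/(x+1)], which is exactly the growth of that factor. The second
    conjunct controls the coefficient multiplying [m - l]. *)
Lemma hcoef_lipschitz l m k : 0 <= l <= 1 -> 0 <= m <= 1 ->
  `|hcoef l k.+1 - hcoef m k.+1| <= `|l - m| * (1 - k.+1%:R^-1) * hcoef 0 k.+1
  /\ hcoef m k.+1 <= hcoef 0 k.+1.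
Proof.
have n2 := N2'.
move=> l01 m01; elim: k => [|k [IH IHm]].
  by rewrite /= subrr normr0 invr1 subrr mulr0 mul0r.
have [/andP[l0 l1] /andP[m0 m1]] := (l01, m01).
have h0 := hcoef_ge0 k.+1 (_ : 0 <= 0 <= 1).
have hm := hcoef_ge0 k.+1 m01.
have k1 : 1 <= k.+1%:R :> R by rewrite ler1n.
set x := (k.+1%:R : R) in IH k1 *.
have k2E : k.+2%:R = x + 1 :> R by rewrite /x -natr1.
have E r : hcoef r k.+2 = (x * (x + N%:R - 1) - r) / ((x + 1) * (2 * x + N%:R)) * hcoef r k.+1.
  by rewrite -k2E.
have b0 : 0 < (x + 1) * (2 * x + N%:R) by apply: mulr_gt0; lra.
rewrite !E k2E; move: IH IHm h0 hm; move: (hcoef l _) (hcoef m _) (hcoef 0 _) => hl hm h0.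
set b := (x + 1) * _ in b0 *; set a := x * _.
have ax : x * (x + 1) <= a by rewrite /a ler_wpM2l//; lra.
move=> IH IHm /(_ ltac:(by rewrite lexx ler01)) h00 hm0.
split; last first.
  rewrite subr0 ler_pM//; last by rewrite ler_pM2r ?invr_gt0//; lra.
  by rewrite divr_ge0 ?ltW//; nra.
have -> : (a - l) / b * hl - (a - m) / b * hm = ((a - l) * (hl - hm) + (m - l) * hm) / b.
  by ring.
rewrite (_ : _ * ((a - 0) / b * h0) = `|l - m| * (1 - (x + 1)^-1) * (a * h0) / b); last by ring.
rewrite normrM [`|b^-1|]gtr0_norm ?invr_gt0// ler_pM2r ?invr_gt0//.
have al : 0 <= a - l by nra.
rewrite (le_trans (ler_normD _ _))// !normrM (ger0_norm al) (ger0_norm hm0) (distrC m).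
have D0 := normr_ge0 (l - m).
apply: (@le_trans _ _ (a * (`|l - m| * (1 - x^-1) * h0) + `|l - m| * h0)).
  apply: lerD; last by rewrite ler_wpM2l.
  by apply: ler_pM => //; lra.
rewrite -subr_ge0.
have -> : `|l - m| * (1 - (x + 1)^-1) * (a * h0) -
    (a * (`|l - m| * (1 - x^-1) * h0) + `|l - m| * h0) =
    `|l - m| * h0 * (a / (x * (x + 1)) - 1).
  by field; apply/andP; split; lra.
rewrite mulr_ge0 ?mulr_ge0// subr_ge0 ler_pdivlMr ?mul1r//.
by apply: mulr_gt0; lra.
Qed.

Lemma radius2_hcoef l : 0 <= l <= 1 -> radius2 (hcoef l).
Proof.
have n2 := N2'.
move=> l01 r r2.
have [m mP] : exists m : nat, N%:R / (2 * r - 1) < m%:R.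
  exists (Num.bound (N%:R / (2 * r - 1))); apply: archi_boundP.
  by rewrite divr_ge0//; lra.
exists m.+1 => -[//|k] mk.
have km : N%:R / (2 * r - 1) <= k.+1%:R.
  by rewrite (le_trans (ltW mP))// ler_nat ltnW.
rewrite ler_pdivrMr in km; last lra.
have -> : hcoef l k.+2 = (k.+1%:R * (k.+1%:R + N%:R - 1) - l) /
  (k.+2%:R * (2 * k.+1%:R + N%:R)) * hcoef l k.+1 by [].
have /andP[l0 l1] := l01.
rewrite normrM ger0_norm ?hcoef_ratio_ge0// ler_wpM2r//.
have k2E : k.+2%:R = k.+1%:R + 1 :> R by rewrite -natr1.
rewrite k2E; have : 1 <= k.+1%:R :> R by rewrite ler1n.
move: (k.+1%:R) km => x km x1.
rewrite ler_pdivrMr; last by apply: mulr_gt0; lra.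
by nra.
Qed.

Definition hsum l t := psum (hcoef l) t.
Definition hsum1 l t := psum (pseries_diffs (hcoef l)) t.
Definition hsum2 l t := psum (pseries_diffs (pseries_diffs (hcoef l))) t.

Lemma is_derive_hsum l t : 0 <= l <= 1 -> `|t| < 2 ->
  is_derive t 1 (hsum l) (hsum1 l t).
Proof. by move=> l01 t2; apply: is_derive_psum => //; exact: radius2_hcoef. Qed.

Lemma is_derive_hsum1 l t : 0 <= l <= 1 -> `|t| < 2 ->
  is_derive t 1 (hsum1 l) (hsum2 l t).
Proof.
move=> l01 t2; apply: is_derive_psum => //.
by apply: radius2_diffs; exact: radius2_hcoef.
Qed.

Lemma continuous_hsum2 l t : 0 <= l <= 1 -> `|t| < 2 -> {for t, continuous (hsum2 l)}.
Proof.
move=> l01 t2; apply/differentiable_continuous/derivable1_diffP.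
have [] // := @is_derive_psum _ (pseries_diffs (pseries_diffs (hcoef l))) t _ t2.
by do 2!apply: radius2_diffs; exact: radius2_hcoef.
Qed.

Lemma hsum0 l : hsum l 0 = 0. Proof. exact: psum0. Qed.

Lemma hsum10 l : hsum1 l 0 = N%:R^-1.
Proof. by rewrite /hsum1 psum0 /pseries_diffs /= mul1r. Qed.

Lemma hsum_ode l t : 0 <= l <= 1 -> `|t| < 2 ->
  t * (2 - t) * hsum2 l t + N%:R * (1 - t) * hsum1 l t = 1 - l * hsum l t.
Proof.
move=> l01 t2; pose c := hcoef l.
have rc := radius2_hcoef l01; have rc1 := radius2_diffs rc.
have rc2 := radius2_diffs rc1.
pose c1 := pseries_diffs c; pose c2 := pseries_diffs c1.
pose sh (u : R^nat) : R^nat := fun k => if k is j.+1 then u j else 0.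
have C0 : pseries c t @ \oo --> hsum l t by exact: radius2_cvg.
have C1 : pseries c1 t @ \oo --> hsum1 l t by exact: radius2_cvg.
have C2 : pseries c2 t @ \oo --> hsum2 l t by exact: radius2_cvg.
have S1 : pseries (sh c1) t @ \oo --> t * hsum1 l t by exact: psum_shift.
have S2 : pseries (sh c2) t @ \oo --> t * hsum2 l t by exact: psum_shift.
have S3 : pseries (sh (sh c2)) t @ \oo --> t * (t * hsum2 l t) by exact: psum_shift.
(* The recurrence [hcoefS] read as the coefficient of [t^k] in the equation, with [sh] standing for
   multiplication by [t]; the right-hand side 1 is the term [k = 0]. *)
have key k : 2 * sh c2 k - sh (sh c2) k + N%:R * c1 k - N%:R * sh c1 k + l * c k =
    (k == 0%N)%:R.
  have h := hcoefS l k.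
  rewrite -[RHS](addrK ((k%:R * (k%:R + N%:R - 1) - l) * hcoef l k)) -h.
  have u0 : hcoef l 0 = 0 by [].
  rewrite /c2 /c1 /c; move: (hcoef l) u0 => u u0.
  case: k {h} => [|[|k]]; rewrite /sh /pseries_diffs.
  - by rewrite u0; ring.
  - by ring.
  - have k2E : k.+3%:R = k%:R + 3 :> R by rewrite -addn3 natrD.
    have k1E : k.+2%:R = k%:R + 2 :> R by rewrite -addn2 natrD.
    have k0E : k.+1%:R = k%:R + 1 :> R by rewrite -natr1.
    by rewrite k2E k1E k0E; ring.
clearbody sh c2 c1.
have L : (fun n => 2 * pseries (sh c2) t n - pseries (sh (sh c2)) t n +
      N%:R * pseries c1 t n - N%:R * pseries (sh c1) t n + l * pseries c t n) @ \oo -->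
    2 * (t * hsum2 l t) - t * (t * hsum2 l t) + N%:R * hsum1 l t
      - N%:R * (t * hsum1 l t) + l * hsum l t.
  apply: cvgD; last by apply: cvgMr.
  apply: cvgB; last by apply: cvgMr.
  apply: cvgD; last by apply: cvgMr.
  by apply: cvgB => //; apply: cvgMr.
have L1 : (fun n => 2 * pseries (sh c2) t n - pseries (sh (sh c2)) t n +
      N%:R * pseries c1 t n - N%:R * pseries (sh c1) t n + l * pseries c t n) @ \oo --> (1 : R).
  rewrite -cvg_shiftS /=; apply: cvg_near_cst; apply: nearW => n.
  rewrite /pseries /series/= !mulr_sumr -sumrB -big_split/= -sumrB -big_split/=.
  rewrite (eq_bigr (fun k => (k == 0%N)%:R * t ^+ k)).
    rewrite big_nat_recl// expr0 mulr1 big1 ?addr0// => i _.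
    by rewrite mul0r.
  by move=> k _; rewrite -key; ring.
have := cvg_unique _ L L1; move=> /(_ (@norm_hausdorff _ _)) E.
by apply: (addIr (l * hsum l t)); rewrite subrK -[RHS]E; ring.
Qed.

(** Sums the coefficient bounds. The case [m = 0] gives [D_l >= (1 - l) D]; the general case gives
    continuity in [l], for the intermediate value theorem. *)
Lemma hsum_lipschitz l m t : 0 <= l <= 1 -> 0 <= m <= 1 -> 0 <= t < 2 ->
  `|hsum l t - hsum m t| <= `|l - m| * hsum 0 t.
Proof.
move=> l01 m01 /andP[t0 t2]; have t2' : `|t| < 2 by rewrite ger0_norm.
have z01 : 0 <= (0 : R) <= 1 by rewrite lexx ler01.
have Cl : pseries (hcoef l) t @ \oo --> hsum l t.
  by apply: radius2_cvg => //; exact: radius2_hcoef.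
have Cm : pseries (hcoef m) t @ \oo --> hsum m t.
  by apply: radius2_cvg => //; exact: radius2_hcoef.
have C0 : cvgn (pseries (hcoef 0) t) by apply: radius2_cvg => //; exact: radius2_hcoef.
have Ln : (fun n => `|pseries (hcoef l) t n - pseries (hcoef m) t n|) @ \oo -->
  `|hsum l t - hsum m t| by apply: cvg_norm; exact: cvgB.
rewrite -(cvg_lim _ Ln)//; apply: limr_le; first by apply/cvg_ex; eexists; exact: Ln.
apply: nearW => n; apply: (@le_trans _ _ (`|l - m| * pseries (hcoef 0) t n)); last first.
  by rewrite ler_wpM2l// psum_ge_partial// => k; exact: hcoef_ge0.
rewrite /pseries /series/= -sumrB mulr_sumr (le_trans (ler_norm_sum _ _ _))//.
apply: ler_sum => k _; rewrite -mulrBl normrM mulrA (ger0_norm (exprn_ge0 _ t0)).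
rewrite ler_wpM2r ?exprn_ge0//; case: k => [|k]; first by rewrite /= subrr normr0 mulr0.
have [/le_trans-> //] := hcoef_lipschitz k l01 m01.
rewrite ler_wpM2r ?hcoef_ge0// ler_piMr// gerBl invr_ge0//.
Qed.

Lemma hsum1_ge t : 0 <= t < 2 -> N%:R^-1 <= hsum1 0 t.
Proof.
move=> /andP[t0 t2]; have t2' : `|t| < 2 by rewrite ger0_norm.
have z01 : 0 <= (0 : R) <= 1 by rewrite lexx ler01.
apply: le_trans (@psum_ge_partial _ (pseries_diffs (hcoef 0)) t 1 _ t0 _); last 2 first.
- by move=> k; rewrite mulr_ge0// hcoef_ge0.
- by apply: radius2_cvg => //; apply: radius2_diffs; exact: radius2_hcoef.
by rewrite /pseries /series/= big_nat1 expr0 mulr1 /pseries_diffs/= mul1r.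
Qed.

(** The ratio of consecutive values of [hcoef 0 k * 2^k] is [2x(x+N-1) / ((x+1)(2x+N))], and it is
    at least [x/(x+1)] precisely when [N >= 2]. *)
Lemma hcoef0_ge k : 2 / N%:R * k.+1%:R^-1 <= hcoef 0 k.+1 * 2 ^+ k.+1.
Proof.
have n2 := N2'.
elim: k => [|k IH]; first by rewrite expr1 invr1 mulr1 mulrC.
have -> : hcoef 0 k.+2 = (k.+1%:R * (k.+1%:R + N%:R - 1) - 0) /
  (k.+2%:R * (2 * k.+1%:R + N%:R)) * hcoef 0 k.+1 by [].
have k2E : k.+2%:R = k.+1%:R + 1 :> R by rewrite -natr1.
rewrite k2E exprS; have x1 : 1 <= k.+1%:R :> R by rewrite ler1n.
move: (k.+1%:R : R) x1 IH => x x1 IH.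
have -> : (x * (x + N%:R - 1) - 0) / ((x + 1) * (2 * x + N%:R)) * hcoef 0 k.+1 *
  (2 * 2 ^+ k.+1) = (2 * (x * (x + N%:R - 1))) / ((x + 1) * (2 * x + N%:R)) *
    (hcoef 0 k.+1 * 2 ^+ k.+1) by ring.
have r0 : 0 <= 2 * (x * (x + N%:R - 1)) / ((x + 1) * (2 * x + N%:R)).
  apply: divr_ge0; first by apply: mulr_ge0 => //; apply: mulr_ge0; lra.
  by apply: mulr_ge0; lra.
apply: le_trans (ler_wpM2l r0 IH).
rewrite -subr_ge0.
have -> : 2 * (x * (x + N%:R - 1)) / ((x + 1) * (2 * x + N%:R)) * (2 / N%:R / x) -
   2 / N%:R / (x + 1) = 2 / N%:R / (x + 1) * ((N%:R - 2) / (2 * x + N%:R)).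
  by field; repeat (apply/andP; split); lra.
by repeat (apply: mulr_ge0 || rewrite invr_ge0); lra.
Qed.

Lemma hsum_unbounded A : exists2 d : R, 0 < d &
  forall t, 2 - d < t < 2 -> A < hsum 0 t.
Proof.
have n2 := N2'.
have z01 : 0 <= (0 : R) <= 1 by rewrite lexx ler01.
have [n nA] : exists n, A < pseries (hcoef 0) 2 n.
  (* Bounded partial sums at [t = 2] would make the harmonic series converge. A single large partial
     sum is then carried to nearby [t < 2] by continuity of a polynomial. *)
  apply: contrapT => /forallNP h; apply: (@dvg_harmonic R).
  apply: nondecreasing_is_cvgn.
    apply/nondecreasing_seqP => k; rewrite /series/= big_nat_recr//= lerDl.
    by rewrite invr_ge0.
  exists (A * N%:R / 2) => _ [k _ <-].
  have := h k.+1; move=> /negP; rewrite -leNgt => hk.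
  rewrite ler_pdivlMr// -ler_pdivrMr; last lra.
  apply: le_trans hk; rewrite /pseries /series /= big_nat_recl//= mul0r add0r.
  rewrite -mulrA mulr_suml; apply: ler_sum => i _.
  by apply: le_trans (hcoef0_ge i); rewrite mulrC.
have cp : (fun t : R => pseries (hcoef 0) t n) @ (2 : R) --> pseries (hcoef 0) 2 n.
  rewrite /pseries /series/=.
  have -> : (fun t : R => \sum_(0 <= k < n) hcoef 0 k * t ^+ k) =
     horner (\poly_(k < n) hcoef 0 k).
    by apply/funext => t; rewrite horner_poly big_mkord.
  rewrite (_ : \sum_(0 <= k < n) _ = (\poly_(k < n) hcoef 0 k).[2]).
    exact: continuous_horner.
  by rewrite horner_poly big_mkord.
have : \forall t \near (2 : R), A < pseries (hcoef 0) t n by exact: (cvgr_gt _ cp _ nA).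
move=> /nbhs_ballP[d /= d0 dP]; exists (Num.min d 1); first by rewrite lt_min d0/=.
move=> t /andP[td t2].
have [td1 td2] : 2 - t < d /\ 2 - t < 1.
  by apply/andP; rewrite -lt_min; lra.
have t0 : 0 <= t by lra.
have pA : A < pseries (hcoef 0) t n.
  by apply: dP; rewrite /ball/= gtr0_norm; lra.
rewrite (lt_le_trans pA)// psum_ge_partial//.
- by move=> k; exact: hcoef_ge0.
- by apply: radius2_cvg; [exact: radius2_hcoef|rewrite ger0_norm].
Qed.

End hypergeometric.

(** * The radial Green operator *)

Section primitive.
Context {R : realType}.

Lemma continuous_primitive (g : R -> R) (a b : R) : continuous g ->
  exists G : R -> R, forall x, a < x < b -> is_derive x 1 G (g x).
Proof.
move=> cg; pose mu := (@lebesgue_measure R).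
exists (fun x => (\int[mu]_(t in `[a, x]) g t)%R) => x /andP[ax xb].
have ig : mu.-integrable `[a, b] (EFin \o g).
  apply: continuous_compact_integrable; first exact: segment_compact.
  exact: continuous_subspaceT.
have [d dE] := continuous_FTC1_closed xb ig ax (cg x).
by apply: DeriveDef => //; rewrite -derive1E.
Qed.

End primitive.

Section weights.
Context {R : realType} (N : nat).
Hypothesis N2 : (2 <= N)%N.
Implicit Types t : R.

(** With [t = 1 - cos theta] these are the powers [N] and [N - 2] of [sin theta]; the square root
    covers odd [N]. They satisfy [p = t(2-t) q] and [p' = N(1-t) q], so [p] is an integrating
    factor. *)
Definition weightp t := Num.sqrt (t * (2 - t)) ^+ N.
Definition weightq t := Num.sqrt (t * (2 - t)) ^+ (N - 2).
Notation p := weightp.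
Notation q := weightq.

Lemma continuous_sqrt_poly : continuous (fun t => Num.sqrt (t * (2 - t))).
Proof.
move=> t; apply: continuous_comp; last exact: sqrt_continuous.
apply: continuousM; first exact: cvg_id.
by apply: continuousB; [exact: cvg_cst|exact: cvg_id].
Qed.

Lemma continuous_weightp : continuous p.
Proof. by move=> t; exact: (@continuous_expf _ _ _ N t (@continuous_sqrt_poly t)). Qed.

Lemma continuous_weightq : continuous q.
Proof. by move=> t; exact: (@continuous_expf _ _ _ (N - 2) t (@continuous_sqrt_poly t)). Qed.

Lemma weightp0 : p 0 = 0.
Proof. by rewrite /p mul0r sqrtr0 expr0n; case: N N2. Qed.

Lemma weightq_ge0 t : 0 <= q t.
Proof. by rewrite exprn_ge0// sqrtr_ge0. Qed.

Lemma weightpq t : 0 < t < 2 -> p t = t * (2 - t) * q t.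
Proof.
move=> /andP[t0 t2]; rewrite /p /q -{1}(subnKC N2) exprD sqr_sqrtr//.
by apply: mulr_ge0; lra.
Qed.

Lemma weightq_gt0 t : 0 < t < 2 -> 0 < q t.
Proof.
move=> /andP[t0 t2]; rewrite exprn_gt0// sqrtr_gt0.
by apply: mulr_gt0; lra.
Qed.

Lemma weightp_gt0 t : 0 < t < 2 -> 0 < p t.
Proof.
move=> /andP[t0 t2]; rewrite exprn_gt0// sqrtr_gt0.
by apply: mulr_gt0; lra.
Qed.

Lemma is_derive_weightp t : 0 < t < 2 -> is_derive t 1 p (N%:R * (1 - t) * q t).
Proof.
move=> /andP[t0 t2]; pose s := fun r : R => r * (2 - r).
have s0 : 0 < s t by apply: mulr_gt0; lra.
have ds : is_derive t 1 s (2 - 2 * t).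
  have h := is_deriveM (is_derive_id t 1) (is_deriveB (is_derive_cst (2 : R) t 1) (is_derive_id t 1)).
  apply: (is_derive_eq h); rewrite /= -![_ *: _]/(_ * _) -[(cst 2 - id) t]/(2 - t); ring.
have h := @is_deriveX R _ _ N t 1 _ (is_derive1_comp (is_derive1_sqrt s0) ds).
have -> : p = (Num.sqrt \o s) ^+ N by apply/funext => y; rewrite exprfctE.
apply: (is_derive_eq h); rewrite -![_ *: _]/(_ * _) /= /q -/(s t).
have r0 : Num.sqrt (s t) != 0 by rewrite gt_eqF// sqrtr_gt0.
move: (Num.sqrt (s t)) r0 => r r0; case: N N2 => [|[|n]]//= _.
by rewrite subSS subSS subn0 exprS; field.
Qed.

(* Multiplying by [p] turns the operator into [(p z)' = q h]. *)
Lemma is_derive_weighted (z h : R -> R) t : 0 < t < 2 ->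
  is_derive t 1 z ((h t - N%:R * (1 - t) * z t) / (t * (2 - t))) ->
  is_derive t 1 (fun s => p s * z s) (q t * h t).
Proof.
move=> t02 dz; have [t0 t2] := andP t02.
have dp := is_derive_weightp t02.
apply: (is_derive_eq (is_deriveM dp dz)).
rewrite -![_ *: _]/(_ * _) weightpq//.
by field; apply/andP; split; lra.
Qed.

(** [p z] is nondecreasing and starts from 0, because [p] vanishes at the pole and [z] is continuous
    there: continuity replaces an initial condition. *)
Lemma radial_comparison (z h : R -> R) (b : R) : b < 2 ->
  (forall t, 0 <= t <= b -> {for t, continuous z}) ->
  (forall t, 0 < t < b ->
    is_derive t 1 z ((h t - N%:R * (1 - t) * z t) / (t * (2 - t)))) ->
  (forall t, 0 < t < b -> 0 <= h t) ->
  forall t, 0 < t <= b -> 0 <= z t.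
Proof.
move=> b2 cz dz h0 t /andP[t0 tb].
have pt : 0 < p t by rewrite weightp_gt0// t0 (le_lt_trans tb).
rewrite -(pmulr_rge0 _ pt).
have := @nondecreasing_of_derive R (fun s => p s * z s) (fun s => q s * h s) 0 t (ltW t0).
rewrite weightp0 mul0r; apply.
- move=> s /andP[s0 st]; apply: is_derive_weighted.
    by rewrite s0 (lt_trans st)// (le_lt_trans tb).
  by apply: dz; rewrite s0 (lt_le_trans st).
- move=> s /andP[s0 st]; rewrite mulr_ge0 ?weightq_ge0// h0// s0.
  by rewrite (lt_le_trans st).
- move=> s /andP[s0 st]; apply: continuous_mulf; first exact: continuous_weightp.
  by apply: cz; rewrite s0 (le_trans st).
Qed.

Let z01 : 0 <= (0 : R) <= 1. Proof. by rewrite lexx ler01. Qed.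
Notation D := (hsum N (0 : R)).
Notation D1 := (hsum1 N (0 : R)).

Lemma is_derive_hsum10 t : 0 < t < 2 ->
  is_derive t 1 D1 ((1 - N%:R * (1 - t) * D1 t) / (t * (2 - t))).
Proof.
move=> /andP[t0 t2]; have t2' : `|t| < 2 by rewrite gtr0_norm.
apply: (is_derive_eq (is_derive_hsum1 N2 z01 t2')).
have E := hsum_ode N2 z01 t2'; rewrite mul0r subr0 in E.
have -> : 1 - N%:R * (1 - t) * D1 t = t * (2 - t) * hsum2 N 0 t by lra.
by field; apply/andP; split; lra.
Qed.

Lemma continuous_hsum1 t : 0 <= t < 2 -> {for t, continuous D1}.
Proof.
move=> /andP[t0 t2]; apply/differentiable_continuous/derivable1_diffP.
have t2' : `|t| < 2 by rewrite ger0_norm.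
by have [] := is_derive_hsum1 N2 z01 t2'.
Qed.

(** The solution is [y = (1/p) \int_0^t q g]. The difficulty is the quotient 0/0 at the pole, whose
    limit is [g 0 / N]. *)
Lemma green_function (g : R -> R) (T : R) : 0 < T < 2 -> continuous g ->
  exists y : R -> R, [/\ continuous y, y 0 = g 0 / N%:R &
    forall t, 0 < t < T ->
      is_derive t 1 y ((g t - N%:R * (1 - t) * y t) / (t * (2 - t)))].
Proof.
move=> /andP[T0 T2] cg.
have cqg : continuous (fun t => q t * g t).
  by move=> t; apply: continuous_mulf; [exact: continuous_weightq|exact: cg].
(* Starting the primitive at -1 makes it differentiable at 0 itself. *)
have [G0 dG0] := continuous_primitive (- 1) 2 cqg.
pose G t := G0 t - G0 0.
have dG t : -1 < t < 2 -> is_derive t 1 G (q t * g t).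
  move=> /dG0 h; have := is_deriveB h (is_derive_cst (G0 0) t 1).
  by rewrite subr0.
have cG t : -1 < t < 2 -> {for t, continuous G}.
  by move=> /dG[h _]; apply/differentiable_continuous/derivable1_diffP.
pose c t := Num.min t T.
(* Constant left of the pole and frozen beyond [T], which makes [y] continuous on the whole line. *)
pose y t := if t <= 0 then g 0 / N%:R else G (c t) / p (c t).
have yE t : 0 < t -> y t = G (c t) / p (c t) by rewrite /y leNgt => ->.
have cE t : t <= T -> c t = t by move=> tT; rewrite /c min_l.
have ct t : 0 < t -> 0 < c t <= T by move=> t0; rewrite /c lt_min t0 T0 ge_min lexx orbT.
have npos t : 0 < t -> \forall s \near t, 0 < s by move=> t0; exact: lt_nbhsr.
exists y; split.
- move=> t; have [t0|t0|->] := ltgtP t 0.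
  + have : \forall s \near t, y s = g 0 / N%:R.
      by apply: filterS (lt_nbhsl t0) => s s0; rewrite /y ltW.
    move=> n; rewrite /continuous_at (nbhs_singleton n); exact: cvg_near_cst.
  + have n : \forall s \near t, G (c s) / p (c s) = y s.
      by apply: filterS (npos _ t0) => s s0; rewrite yE.
    rewrite /continuous_at -(nbhs_singleton n); apply: cvg_trans (near_eq_cvg n) _.
    have /andP[c0 cT] := ct _ t0.
    have cc : {for t, continuous c}.
      have h : {for t, continuous ((fun s : R => s : R^o) \min (fun=> T : R^o))}.
        by apply: continuous_min; [exact: cvg_id|exact: cvg_cst].
      exact: h.
    have c02 : 0 < c t < 2 by rewrite c0 (le_lt_trans cT).
    apply: cvgM.
      apply: (@continuous_comp _ _ _ c G t) => //; apply: cG; lra.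
    apply: cvgV; first by rewrite gt_eqF// weightp_gt0.
    by apply: (@continuous_comp _ _ _ c p t) => //; exact: continuous_weightp.
  + apply/cvgrPdist_lt => e e0.
    have D10 : D1 0 = N%:R^-1 by exact: hsum10.
    pose e1 := e / 3; have e10 : 0 < e1 by rewrite divr_gt0.
    (* The bound 1 ensures [D1 <= 1] near 0, since [D1 0 = 1/N <= 1/2]; the other bound makes
       [g 0 * (D1 0 - D1 s)] small, the [+ 1] avoiding a division by zero. *)
    pose e2 := Num.min 1 (e1 / (`|g 0| + 1)).
    have g0p : 0 < `|g 0| + 1 by rewrite ltr_wpDl.
    have e20 : 0 < e2 by rewrite lt_min ltr01 divr_gt0.
    have n1 : \forall s \near (0 : R), `|g 0 - g s| <= e1.
      exact: (cvgr_dist_le _ _ (cg 0) _ e10).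
    have n2 : \forall s \near (0 : R), `|D1 0 - D1 s| <= e2 / 2.
      have e22 : 0 < e2 / 2 by rewrite divr_gt0.
      have c0 : {for (0 : R), continuous D1} by apply: continuous_hsum1; rewrite lexx ltr0n.
      exact: (cvgr_dist_le _ _ c0 _ e22).
    have : \forall s \near (0 : R), `|g 0 - g s| <= e1 /\ `|D1 0 - D1 s| <= e2 / 2.
      by apply: filterS2 n1 n2.
    move=> /nbhs_ballP[d /= d0 dP].
    exists (Num.min d T); first by rewrite /= lt_min d0.
    move=> s /=; rewrite sub0r normrN lt_min => /andP[sd sT].
    rewrite /y lexx; case: ifPn => [_|]; first by rewrite subrr normr0.
    rewrite -ltNge => s0; rewrite gtr0_norm// in sd sT.
    rewrite cE ?ltW//.
    have s02 : 0 < s < 2 by rewrite s0 (lt_trans sT).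
    have p0 := weightp_gt0 s02.
    have near0 r : 0 <= r <= s -> `|g 0 - g r| <= e1 /\ `|D1 0 - D1 r| <= e2 / 2.
      move=> /andP[r0 rs]; apply: dP.
      by rewrite /ball/= sub0r normrN ger0_norm// (le_lt_trans rs).
    have D1p r : 0 <= r <= s -> 0 <= D1 r <= 1.
      move=> rs; have [_] := near0 _ rs; rewrite D10.
      have N0 : 0 < N%:R^-1 :> R by rewrite invr_gt0 ltr0n (leq_trans _ N2).
      have N12 : N%:R^-1 <= 2^-1 :> R by rewrite lef_pV2 ?posrE ?ler_nat ?ltr0n ?(leq_trans _ N2).
      have e21 : e2 <= 1 by rewrite /e2 ge_min lexx.
      have := @hsum1_ge R N N2 r; rewrite ler_norml => h h'.
      have : N%:R^-1 <= D1 r by apply: h; lra.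
      by move: h' => /andP[]; lra.
    (* [p D1] is the primitive of [q] vanishing at 0, so where [g] is within [e1] of [g 0], [G] is
       within [e1 p D1] of [g 0 p D1]. Dividing by [p] replaces the quotient 0/0 by the continuous
       function [D1]. The sign [sg] handles both inequalities together. *)
    have cmp (sg : R) : `|sg| = 1 -> 0 <= e1 * (p s * D1 s) + sg * (G s - g 0 * (p s * D1 s)).
      move=> sg1.
      have := @nondecreasing_of_derive R
        (fun r => e1 * (p r * D1 r) + sg * (G r - g 0 * (p r * D1 r)))
        (fun r => e1 * (q r * 1) + sg * (q r * g r - g 0 * (q r * 1))) 0 s (ltW s0).
      rewrite weightp0 mul0r !mulr0 subr0 add0r /G subrr mulr0; apply.
      - move=> r /andP[r0 rs]; have r02 : 0 < r < 2 by lra.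
        have dw := is_derive_weighted (h := fun=> 1) r02 (is_derive_hsum10 r02).
        have dGr : is_derive r 1 G (q r * g r) by apply: dG; lra.
        exact: (is_deriveD (is_deriveZ e1 dw) (is_deriveZ sg (is_deriveB dGr (is_deriveZ (g 0) dw)))).
      - move=> r /andP[r0 rs]; have rs' : 0 <= r <= s by rewrite !ltW.
        have [gr _] := near0 r rs'.
        rewrite /= (_ : e1 * _ + _ = q r * (e1 + sg * (g r - g 0))); last by ring.
        rewrite mulr_ge0 ?weightq_ge0//.
        have : `|sg * (g r - g 0)| <= e1 by rewrite normrM sg1 mul1r distrC.
        by rewrite ler_norml => /andP[]; lra.
      - move=> r /andP[r0 rs].
        have cpD : {for r, continuous (fun r => p r * D1 r)}.
          apply: continuous_mulf; first exact: continuous_weightp.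
          by apply: continuous_hsum1; lra.
        have cc (k : R) : {for r, continuous (fun=> k)} by exact: cst_continuous.
        have cGr : {for r, continuous G} by apply: cG; lra.
        apply: continuous_addf; first exact: continuous_mulf.
        apply: continuous_mulf => //; apply: continuousB => //.
        exact: continuous_mulf.
    have key : `|G s / p s - g 0 * D1 s| <= e1 * D1 s.
      have h1 := cmp 1 (normr1 _); have h2 := cmp (-1) (normrN1 _).
      rewrite ler_norml -subr_ge0 -[X in _ && X]subr_ge0.
      rewrite (_ : _ - - _ = (e1 * (p s * D1 s) + 1 * (G s - g 0 * (p s * D1 s))) / p s); last by field; rewrite gt_eqF.
      rewrite (_ : e1 * D1 s - _ = (e1 * (p s * D1 s) + -1 * (G s - g 0 * (p s * D1 s))) / p s); last by field; rewrite gt_eqF.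
      by rewrite !divr_ge0// ltW.
    have ss : 0 <= s <= s by rewrite lexx ltW.
    have [_ hD] := near0 _ ss; have /andP[Ds0 Ds1] := D1p _ ss.
    rewrite -D10 (_ : _ - _ = g 0 * (D1 0 - D1 s) - (G s / p s - g 0 * D1 s)); last by ring.
    rewrite (le_lt_trans (ler_normB _ _))// normrM.
    have : `|g 0| * `|D1 0 - D1 s| <= e1.
      apply: (@le_trans _ _ ((`|g 0| + 1) * (e1 / (`|g 0| + 1)))); last first.
        by rewrite mulrCA divff ?mulr1// gt_eqF.
      apply: ler_pM => //; first by rewrite lerDl.
      have e2e : e2 <= e1 / (`|g 0| + 1) by rewrite /e2 ge_min lexx orbT.
      by rewrite (le_trans hD)//; lra.
    have : e1 * D1 s <= e1 by rewrite ler_piMr// ltW.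
    have : e = e1 + e1 + e1 by rewrite /e1; field.
    by move: key; lra.
- by rewrite /y lexx.
- move=> t /andP[t0 tT].
  have t02 : 0 < t < 2 by rewrite t0 (lt_trans tT).
  have n : \forall s \near t, G s / p s = y s.
    have n1 : \forall s \near t, s < T by exact: lt_nbhsl.
    by apply: filterS2 (npos _ t0) n1 => s s0 sT; rewrite yE// cE// ltW.
  apply: (near_eq_is_derive n).
  have p0 := weightp_gt0 t02; have q0 := weightq_gt0 t02.
  have dV : is_derive t 1 (fun s => (p s)^-1) (- (p t)^-2 * (N%:R * (1 - t) * q t)).
    have [dp dpE] := is_derive_weightp t02.
    apply: DeriveDef; first by apply: derivableV => //; rewrite gt_eqF.
    by rewrite deriveV// ?gt_eqF// dpE.
  apply: (is_derive_eq (is_deriveM (dG t _) dV)); first by lra.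
  rewrite -![_ *: _]/(_ * _) -(nbhs_singleton n) /= weightpq//.
  by field; repeat (apply/andP; split); lra.
Qed.

End weights.

(** * Banach fixed points for continuous functions, with distances measured on a segment *)

Section fixpoint.
Context {R : realType}.

Definition clamp (a b t : R) : R := Num.max a (Num.min t b).

Lemma clamp_itv (a b t : R) : a <= b -> a <= clamp a b t <= b.
Proof. by move=> ab; rewrite /clamp le_max lexx ge_max ab ge_min lexx orbT. Qed.

Lemma clamp_id (a b t : R) : a <= t <= b -> clamp a b t = t.
Proof. by move=> /andP[at_ tb]; rewrite /clamp min_l// max_r. Qed.

Lemma continuous_clamp (a b : R) : continuous (clamp a b).
Proof.
move=> t.
have h : {for t, continuous ((fun s : R => s : R^o) \min (fun=> b : R^o))}.
  by apply: continuous_min; [exact: cvg_id|exact: cvg_cst].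
have h' : {for t, continuous ((fun=> a : R^o) \max ((fun s : R => s : R^o) \min (fun=> b : R^o)))}.
  by apply: continuous_max; [exact: cvg_cst|exact: h].
exact: h'.
Qed.

Lemma clamp_lipschitz (a b s t : R) : `|clamp a b s - clamp a b t| <= `|s - t|.
Proof.
have mm x y : `|Num.min x b - Num.min y b| <= `|x - y|.
  have := ler_norm (x - y); have := ler_norm (y - x); rewrite (distrC y).
  by case: (leP x b) => xb; case: (leP y b) => yb; move=> *; rewrite ler_norml; lra.
apply: le_trans (mm s t); rewrite /clamp.
move: (Num.min s b) (Num.min t b) => x y.
have := ler_norm (x - y); have := ler_norm (y - x); rewrite (distrC y).
by case: (leP a x) => xb; case: (leP a y) => yb; move=> *; rewrite ler_norml; lra.
Qed.

(** Functions live on all of R but are compared on [[0, T]] only. The limit is therefore taken at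
    the clamped argument, which gives a function continuous everywhere that solves the equation on
    [[0, T]]. Any uniform bound [m] plays the role of the sup distance. *)
Lemma contraction_fixpoint (S : (R -> R) -> (R -> R)) (k T : R) :
  0 <= T -> 0 <= k < 1 ->
  (forall w, continuous w -> continuous (S w)) ->
  (forall w v m, continuous w -> continuous v ->
    (forall t, 0 <= t <= T -> `|w t - v t| <= m) ->
    forall t, 0 <= t <= T -> `|S w t - S v t| <= k * m) ->
  exists2 w, continuous w & forall t, 0 <= t <= T -> S w t = w t.
Proof.
move=> T0 /andP[k0 k1] cS hS; pose w n := iter n S (fun=> 0 : R).
have cw n : continuous (w n).
  by elim: n => [|n IH]; [move=> t; exact: cvg_cst|exact: cS].
have [M M0 hM] : exists2 M, 0 <= M & forall t, 0 <= t <= T -> `|w 1%N t - w 0%N t| <= M.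
  have cn : {within `[0, T], continuous (fun t => `|w 1%N t - w 0%N t|)}.
    apply: continuous_subspaceT => t; apply: cvg_norm.
    by apply: cvgB; exact: cw.
  have [c _ hc] := EVT_max T0 cn.
  by exists (`|w 1%N c - w 0%N c|) => // t tT; apply: hc; rewrite in_itv.
have step n t : 0 <= t <= T -> `|w n.+1 t - w n t| <= M * k ^+ n.
  elim: n t => [|n IH] t tT; first by rewrite expr0 mulr1 hM.
  rewrite exprS mulrCA.
  exact: (hS (w n.+1) (w n) _ (cw _) (cw _) IH).
pose B n := M / (1 - k) * k ^+ n.
have B0 n : 0 <= B n by rewrite mulr_ge0 ?divr_ge0 ?exprn_ge0//; lra.
(* The exact geometric factor [1 - k ^+ j] is kept so that the induction on [j] closes. *)
have far n j t : 0 <= t <= T -> `|w (j + n)%N t - w n t| <= M / (1 - k) * k ^+ n * (1 - k ^+ j).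
  move=> tT; elim: j => [|j IH]; first by rewrite add0n subrr normr0 expr0 subrr mulr0.
  rewrite addSn -(subrK (w (j + n)%N t) (w _ t)) -addrA (le_trans (ler_normD _ _))//.
  rewrite (le_trans (lerD (step _ _ tT) IH))// exprD exprS.
  rewrite (_ : M * _ + _ = M / (1 - k) * k ^+ n * (1 - k * k ^+ j))//.
  by field; lra.
have far' n m t : 0 <= t <= T -> (n <= m)%N -> `|w m t - w n t| <= B n.
  move=> tT nm; rewrite -(subnK nm) (le_trans (far _ _ _ tT))//.
  by apply: ler_piMr; [exact: B0|rewrite gerBl exprn_ge0].
have cvw t : 0 <= t <= T -> cvgn (fun n => w n t).
  move=> tT; have E : (fun n => w n t) = series (fun n => w n.+1 t - w n t).
    by apply/funext => n; rewrite /series/= telescope_sumr// subr0.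
  rewrite E; apply: normed_cvg.
  apply: (@series_le_cvg _ _ (geometric M k)) => [n|n|n|].
  - exact: normr_ge0.
  - by rewrite /= mulr_ge0 ?exprn_ge0.
  - exact: step.
  - by apply: is_cvg_geometric_series; rewrite ger0_norm.
pose u t := limn (fun n => w n (clamp 0 T t)).
have tail n t : 0 <= t <= T -> `|u t - w n t| <= B n.
  move=> tT; rewrite /u clamp_id//.
  have L : (fun m => `|w m t - w n t|) @ \oo --> `|limn (fun n => w n t) - w n t|.
    by apply: cvg_norm; apply: cvgB; [exact: cvw|exact: cvg_cst].
  rewrite -(cvg_lim _ L)//; apply: limr_le; first by apply/cvg_ex; eexists; exact: L.
  by exists n => // m /= nm; exact: far'.
have small e : 0 < e -> exists n, B n < e.
  move=> e0; have L : geometric (M / (1 - k)) k @ \oo --> (0 : R).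
    by apply: cvg_geometric; rewrite ger0_norm.
  have [n _ /(_ n (leqnn n)) /= h] := cvgr_lt _ L _ e0.
  by exists n.
have cu : continuous u.
  move=> t; apply/cvgrPdist_lt => e e0.
  have [n nB] := small (e / 3) (divr_gt0 e0 (ltr0Sn _ _)).
  have cc : {for t, continuous (w n \o clamp 0 T)}.
    by apply: continuous_comp; [exact: continuous_clamp|exact: cw].
  have e30 : 0 < e / 3 by rewrite divr_gt0.
  have nn : \forall s \near t, `|w n (clamp 0 T t) - w n (clamp 0 T s)| < e / 3.
    exact: (cvgr_dist_lt _ _ cc _ e30).
  apply: filterS nn => s h.
  have uc r : u r = u (clamp 0 T r) by rewrite /u (clamp_id (clamp_itv r T0)).
  have h1 := tail n _ (clamp_itv t T0); have h2 := tail n _ (clamp_itv s T0).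
  rewrite uc (uc s); move: h h1 h2.
  move: (u _) (u _) (w n _) (w n _) => a b c d; rewrite !ltr_norml !ler_norml.
  by move=> /andP[? ?] /andP[? ?] /andP[? ?]; apply/andP; lra.
exists u => // t tT.
have key n : `|S u t - u t| <= B n + B n.
  have h1 : `|S u t - w n.+1 t| <= k * B n.
    by apply: (hS u (w n)) => // s sT; exact: tail.
  have h2 := tail n.+1 t tT.
  have kB : k * B n <= B n by rewrite ler_piMl// ltW.
  have h3 : B n.+1 = k * B n by rewrite /B exprS; ring.
  rewrite h3 in h2; move: h1 h2; rewrite !ler_norml.
  by move=> /andP[? ?] /andP[? ?]; apply/andP; lra.
apply/eqP; rewrite -subr_eq0 -normr_eq0 eq_le normr_ge0 andbT leNgt; apply/negP => h.
have [n nB] := small _ (divr_gt0 h (ltr0Sn _ 1)).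
by have := key n; lra.
Qed.

End fixpoint.

(** * Bounds for the radial Green operator and regularity at the pole *)

Section profile_equation.
Context {R : realType} (N : nat).
Hypothesis N2 : (2 <= N)%N.
Implicit Types (t T : R) (g y : R -> R).
Notation D := (hsum N (0 : R)).
Notation D1 := (hsum1 N (0 : R)).
Let z01 : 0 <= (0 : R) <= 1. Proof. by rewrite lexx ler01. Qed.

(** [y] is the derivative [w'] of the regular solution of [L w = g]; at [t = 0] the equation reduces
    to [N y 0 = g 0]. *)
Definition green_for T g y := [/\ continuous y, y 0 = g 0 / N%:R &
    forall t, 0 < t < T ->
      is_derive t 1 y ((g t - N%:R * (1 - t) * y t) / (t * (2 - t)))].

Lemma green_for_lin T a b g1 y1 g2 y2 : green_for T g1 y1 -> green_for T g2 y2 ->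
  green_for T (fun t => a * g1 t + b * g2 t) (fun t => a * y1 t + b * y2 t).
Proof.
move=> [c1 e1 d1] [c2 e2 d2]; split.
- move=> t; have cc (k : R) : {for t, continuous (fun=> k)} by exact: cst_continuous.
  exact: (continuous_addf (continuous_mulf (cc a) (c1 t)) (continuous_mulf (cc b) (c2 t))).
- by rewrite e1 e2; ring.
- move=> t tT; apply: (is_derive_eq (is_deriveD (is_deriveZ a (d1 t tT)) (is_deriveZ b (d2 t tT)))).
  by rewrite -![_ *: _]/(_ * _); ring.
Qed.

(** [D1] is the solution for the source 1, so [y - k D1] has the nonnegative source [g - k]. *)
Lemma green_lower T k g y : T < 2 -> green_for T g y ->
  (forall t, 0 <= t <= T -> k <= g t) ->
  forall t, 0 <= t <= T -> k * D1 t <= y t.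
Proof.
move=> T2 [cy y0 dy] kg t /andP[]; rewrite le_eqVlt => /predU1P[<- T0|t0 tT].
  rewrite y0 [D1 0]hsum10 ler_wpM2r ?invr_ge0//.
  by apply: kg; rewrite lexx T0.
rewrite -subr_ge0.
apply: (@radial_comparison R N N2 (fun s => y s - k * D1 s) (fun s => g s - k) T) => //.
- move=> s /andP[s0 sT]; have s2 : 0 <= s < 2 by rewrite s0 (le_lt_trans sT).
  apply: continuousB; first exact: cy.
  by apply: continuous_mulf; [exact: cst_continuous|exact: continuous_hsum1].
- move=> s /andP[s0 sT]; have s2 : 0 < s < 2 by rewrite s0 (lt_trans sT).
  have ds := dy s (introT andP (conj s0 sT)).
  apply: (is_derive_eq (is_deriveB ds (is_deriveZ k (is_derive_hsum10 N2 s2)))).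
  by rewrite -![_ *: _]/(_ * _); ring.
- by move=> s /andP[s0 sT]; rewrite subr_ge0 kg// !ltW.
- by rewrite t0 tT.
Qed.

Lemma primitive_lower T k y Y : 0 < T < 2 ->
  (forall t, 0 <= t <= T -> k * D1 t <= y t) ->
  (forall t, -1 < t < 2 -> is_derive t 1 Y (y t)) ->
  forall t, 0 <= t <= T -> k * (D T - D t) <= Y T - Y t.
Proof.
move=> /andP[T0 T2] ky dY t /andP[t0 tT].
have dA (s : R) : 0 <= s < 2 -> is_derive s 1 (fun s => Y s - k * D s) (y s - k * D1 s).
  move=> /andP[s0 s2]; have s2' : `|s| < 2 by rewrite ger0_norm.
  have ds : is_derive s 1 Y (y s) by apply: dY; rewrite s2 andbT; lra.
  exact: (is_deriveB ds (is_deriveZ k (is_derive_hsum N2 z01 s2'))).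
suff : Y t - k * D t <= Y T - k * D T by lra.
apply: (@nondecreasing_of_derive R (fun s => Y s - k * D s) (fun s => y s - k * D1 s) t T tT).
- by move=> s /andP[ts sT]; apply: dA; lra.
- by move=> s /andP[ts sT]; rewrite subr_ge0 ky//; lra.
- move=> s /andP[ts sT]; apply/differentiable_continuous/derivable1_diffP.
  have s2 : 0 <= s < 2 by lra.
  by have [] := dA s s2.
Qed.

Lemma hsum_ge0 t : 0 <= t < 2 -> 0 <= D t.
Proof.
move=> /andP[t0 t2]; have t2' : `|t| < 2 by rewrite ger0_norm.
have C : cvgn (pseries (hcoef N (0 : R)) t) by apply: radius2_cvg => //; exact: radius2_hcoef.
have := @psum_ge_partial R (hcoef N 0) t 0 (fun k => hcoef_ge0 N2 k z01) t0 C.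
by rewrite /pseries /series /= big_geq.
Qed.

Lemma hsum_lt s t : 0 <= s < t -> t < 2 -> D s < D t.
Proof.
move=> /andP[s0 st] t2.
have dD (r : R) : 0 <= r < 2 -> is_derive r 1 D (D1 r).
  by move=> /andP[r0 r2]; apply: is_derive_hsum => //; rewrite ger0_norm.
have [r||c] := @MVT R D D1 s t st.
- by rewrite in_itv/= => /andP[sr rt]; apply: dD; lra.
- apply: continuous_in_subspaceT => z; rewrite inE/= in_itv/= => /andP[sr rt].
  apply/differentiable_continuous/derivable1_diffP.
  have z02 : 0 <= z < 2 by lra.
  by have [] := dD z z02.
rewrite in_itv/= => /andP[sc ct] E; rewrite -subr_gt0 E mulr_gt0 ?subr_gt0//.
apply: lt_le_trans (hsum1_ge N2 _); last by lra.
by rewrite invr_gt0 ltr0n (leq_trans _ N2).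
Qed.

(* The right derivative [beta] of [y] at the pole is read off the equation at
   first order; comparing [y] with [g 0 / N + beta t +- e t] makes it a two-sided
   C^1 extension. *)
Lemma green_C1 T g y (g1 : R) : 0 < T < 2 -> continuous g -> green_for T g y ->
  (forall e : R, 0 < e -> \forall t \near 0^'+, `|g t - g 0 - g1 * t| <= e * t) ->
  let beta := (g1 + g 0) / (N%:R + 2) in
  let yx t := if t <= 0 then g 0 / N%:R + beta * t else y t in
  let y1 t := if t <= 0 then beta else (g t - N%:R * (1 - t) * y t) / (t * (2 - t)) in
  forall t, t < T -> is_derive t 1 yx (y1 t) /\ {for t, continuous y1}.
Proof.
move=> /andP[T0 T2] cg [cy y0 dy] hg1 beta yx y1 t tT.
have n2 : 2 <= N%:R :> R by rewrite ler_nat.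
have [t0|t0|t0] := ltgtP t 0.
- have n : \forall s \near t, s < 0 by exact: lt_nbhsl.
  split.
    apply: (near_eq_is_derive (f := fun s => g 0 / N%:R + beta * s)).
      by apply: filterS n => s s0; rewrite /yx ltW.
    apply: (is_derive_eq (is_deriveD (is_derive_cst (g 0 / N%:R) t 1) (is_deriveZ beta (is_derive_id t 1)))).
    by rewrite /y1 ltW// add0r [_ *: _]mulr1.
  have n' : \forall s \near t, y1 s = beta by apply: filterS n => s s0; rewrite /y1 ltW.
  rewrite /prop_for /continuous_at (nbhs_singleton n'); exact: cvg_near_cst.
- have n : \forall s \near t, 0 < s by exact: lt_nbhsr.
  have t0T : 0 < t < T by rewrite t0 tT.
  have cyt := cy t; have cgt := cg t.
  split.
    apply: (near_eq_is_derive (f := y)).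
      by apply: filterS n => s s0; rewrite /yx leNgt s0.
    by rewrite /y1 leNgt t0; exact: dy.
  have n' : \forall s \near t, (g s - N%:R * (1 - s) * y s) / (s * (2 - s)) = y1 s.
    by apply: filterS n => s s0; rewrite /y1 leNgt s0.
  rewrite /prop_for /continuous_at -(nbhs_singleton n'); apply: cvg_trans (near_eq_cvg n') _.
  apply: cvgM; last first.
    apply: cvgV; first by rewrite gt_eqF// mulr_gt0//; lra.
    by apply: cvgM; [exact: cvg_id|apply: cvgB; [exact: cvg_cst|exact: cvg_id]].
  apply: cvgB; first exact: cgt.
  apply: cvgM; last exact: cyt.
  by apply: cvgM; [exact: cvg_cst|apply: cvgB; [exact: cvg_cst|exact: cvg_id]].
rewrite {t tT}t0.
(* The remainder [z] solves the same equation with source [h]. The choice of [beta] cancels the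
   first-order terms, so [h] is o(s), its quadratic term being what [beta s] leaves over. *)
pose alpha := g 0 / N%:R; pose z s := y s - alpha - beta * s.
pose h s := g s - g 0 - g1 * s + (N%:R + 1) * beta * s ^+ 2.
have dz s : 0 < s < T -> is_derive s 1 z ((h s - N%:R * (1 - s) * z s) / (s * (2 - s))).
  move=> sT; have := is_deriveB (is_deriveB (dy s sT) (is_derive_cst alpha s 1))
    (is_deriveZ beta (is_derive_id s 1)).
  move=> H; apply: (is_derive_eq H); rewrite [beta *: _]mulr1 subr0 /h /z /alpha /beta.
  have /andP[s0 sT'] := sT.
  by field; repeat (apply/andP; split); lra.
have small e : 0 < e -> exists2 d : R, 0 < d < T & forall s, 0 < s < d ->
    `|h s| <= e * s /\ `|z s| <= e * s.
  move=> e0; have e20 : 0 < e / 2 by rewrite divr_gt0.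
  have [d /= d0 dP] := hg1 _ e20.
  pose K := (N%:R + 1) * `|beta| + 1.
  have K1 : 1 <= K by rewrite /K lerDr mulr_ge0//; lra.
  (* [T / 2] keeps the interval inside [(0, T)], [1/2] keeps [1 - r] positive for the barrier, and
     [e / (2 * K)] limits the quadratic term of [h] to [e / 2 * s]. *)
  pose d' := Num.min (Num.min d (T / 2)) (Num.min (1/2) (e / (2 * K))).
  have d'0 : 0 < d'.
    by rewrite !lt_min d0 !divr_gt0//=; lra.
  have [dd dT d1 dK] : [/\ d' <= d, d' <= T / 2, d' <= 1/2 & d' <= e / (2 * K)].
    by split; rewrite /d' !ge_min lexx ?orbT.
  have hs s : 0 < s < d' -> `|h s| <= e * s.
    move=> /andP[s0 sd]; rewrite /h (le_trans (ler_normD _ _))//.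
    have -> : e * s = e / 2 * s + e / 2 * s by field.
    apply: lerD.
      by apply: dP => //=; rewrite sub0r normrN gtr0_norm//; lra.
    rewrite normrM [`|(N%:R + 1) * _|]normrM (ger0_norm (_ : 0 <= N%:R + 1)); last by lra.
    rewrite (ger0_norm (sqr_ge0 _)) expr2 mulrA ler_pM2r//.
    have : K * s <= e / 2.
      apply: (@le_trans _ _ (K * (e / (2 * K)))).
        by rewrite ler_pM2l; lra.
      by rewrite le_eqVlt; apply/orP; left; apply/eqP; field; lra.
    by apply: le_trans; rewrite ler_pM2r// /K lerDl.
  exists d'; first by lra.
  move=> s sd; split; first exact: hs.
  (* The barrier [e s] has source [e (s(2-s) + N(1-s)s) >= e s], which dominates [|h|]; comparison
     with [e s + z] and [e s - z] bounds [|z|]. *)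
  have bound (sg : R) : `|sg| = 1 -> 0 <= e * s + sg * z s.
    move=> sg1; have /andP[s0 sd'] := sd.
    apply: (@radial_comparison R N N2 (fun s => e * s + sg * z s)
      (fun r => e * (r * (2 - r) + N%:R * (1 - r) * r) + sg * h r) d').
    - lra.
    - move=> r /andP[r0 rd].
      have cc (k : R) : {for r, continuous (fun=> k)} by exact: cst_continuous.
      have cid : {for r, continuous (fun r : R => r)} by exact: cvg_id.
      apply: continuous_addf; apply: continuous_mulf => //.
      apply: continuousB; last exact: continuous_mulf.
      by apply: continuousB => //; exact: cy.
    - move=> r /andP[r0 rd]; have rT : 0 < r < T by rewrite r0; lra.
      apply: (is_derive_eq (is_deriveD (is_deriveZ e (is_derive_id r 1)) (is_deriveZ sg (dz r rT)))).
      rewrite [e *: _]mulr1 -[_ *: _]/(_ * _).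
      by field; apply/andP; split; lra.
    - move=> r rd; have /andP[r0 rd'] := rd.
      have : `|sg * h r| <= e * r by rewrite normrM sg1 mul1r hs.
      rewrite ler_norml => /andP[+ _].
      have : e * r <= e * (r * (2 - r) + N%:R * (1 - r) * r).
        rewrite ler_pM2l//.
        have -> : r * (2 - r) + N%:R * (1 - r) * r = r * ((2 - r) + N%:R * (1 - r)) by ring.
        rewrite ler_peMr ?ltW//.
        have : 0 <= N%:R * (1 - r) by rewrite mulr_ge0//; lra.
        by lra.
      by lra.
    - by rewrite s0 ltW.
  have b1 := bound 1 (normr1 _); have b2 := bound (-1) (normrN1 _).
  by rewrite ler_norml; apply/andP; lra.
split.
  have y10 : y1 0 = beta by rewrite /y1 lexx.
  have yx0 : yx 0 = alpha by rewrite /yx lexx mulr0 addr0.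
  have lim : (fun r : R => r^-1 *: ((yx \o shift 0) (r *: 1) - yx 0)) @ 0^' --> beta.
    apply/cvgrPdist_le => e e0; have [d /andP[d0 _] dP] := small e e0.
    exists d; first exact: d0.
    move=> r /=; rewrite sub0r normrN => rd r0.
    rewrite addr0 [r *: 1]mulr1 yx0 -[_ *: _]/(_ * _).
    have [rn|rp] := leP r 0.
      rewrite /yx rn (_ : beta - _ = 0) ?normr0 ?ltW// /alpha.
      by field; rewrite r0; lra.
    rewrite /yx [r <= 0]leNgt rp/= (_ : beta - _ = - (z r / r)); last first.
      by rewrite /z; field.
    rewrite normrN normrM normfV (gtr0_norm rp) ler_pdivrMr//.
    by have [] := dP r; rewrite ?rp//; move: rd; rewrite gtr0_norm.
  apply: DeriveDef; first by apply/cvg_ex; exists beta.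
  by rewrite y10; apply/cvg_lim.
rewrite /prop_for /continuous_at {2}/y1 lexx.
(* The numerator [h - N(1-r)z] is at most [(N+1) e' r] in absolute value, while the denominator
   [r(2-r)] is at least [r]. *)
apply/cvgrPdist_le => e e0; pose e' := e / (N%:R + 1).
have e'0 : 0 < e' by rewrite divr_gt0//; lra.
have [d /andP[d0 dT] dP] := small _ e'0.
exists (Num.min d 1); first by rewrite /= lt_min d0/=.
move=> r /=; rewrite sub0r normrN lt_min => /andP[rd r1].
rewrite /y1; case: ifPn => [_|]; first by rewrite subrr normr0 ltW.
rewrite -ltNge => r0; rewrite gtr0_norm// in rd r1.
have [hr zr] := dP r (introT andP (conj r0 rd)).
rewrite (_ : beta - _ = - ((h r - N%:R * (1 - r) * z r) / (r * (2 - r)))); last first.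
  by rewrite /h /z /alpha /beta; field; repeat (apply/andP; split); lra.
have r20 : 0 < r * (2 - r) by rewrite mulr_gt0//; lra.
rewrite normrN normrM normfV (gtr0_norm r20) ler_pdivrMr//.
rewrite (le_trans (ler_normB _ _))// !normrM (ger0_norm (_ : 0 <= N%:R :> R))//.
rewrite (gtr0_norm (_ : 0 < 1 - r)); last lra.
have : N%:R * (1 - r) * `|z r| <= N%:R * (e' * r).
  rewrite -mulrA ler_wpM2l//.
  apply: (@le_trans _ _ (1 * `|z r|)); first by rewrite ler_wpM2r//; lra.
  by rewrite mul1r.
have E : e = e' * (N%:R + 1) by rewrite /e'; field; lra.
have : e * r <= e * (r * (2 - r)).
  by rewrite ler_pM2l// ler_peMr ?ltW//; lra.
have : e * r = e' * r + N%:R * (e' * r) by rewrite E; ring.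
by lra.
Qed.

End profile_equation.

(** * Solving the nonlinear radial problem *)

Section nonlinear_profile.
Context {R : realType} (N : nat).
Hypothesis N2 : (2 <= N)%N.
Notation D := (hsum N (0 : R)).
Notation D1 := (hsum1 N (0 : R)).
Let z01 : 0 <= (0 : R) <= 1. Proof. by rewrite lexx ler01. Qed.

Lemma derivable_right_approx (G : R -> R) (d : R) : is_derive (0 : R) 1 G d ->
  forall e : R, 0 < e -> \forall t \near 0^'+, `|G t - G 0 - d * t| <= e * t.
Proof.
move=> [dG dE] e e0.
have cv : (fun r : R => r^-1 *: ((G \o shift 0) (r *: 1) - G 0)) @ 0^' --> d.
  by rewrite -dE; exact: dG.
have [r /= r0 rP] := cvgr_dist_le _ _ cv _ e0.
exists r; first exact: r0.
move=> t /= tr t0; have := rP t tr; rewrite gt_eqF// => /(_ isT).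
rewrite addr0 [t *: 1]mulr1 -[_ *: _]/(_ * _) => h.
rewrite (_ : _ - _ = - ((d - t^-1 * (G t - G 0)) * t)); last by field; rewrite gt_eqF.
by rewrite normrN normrM (gtr0_norm t0) ler_pM2r.
Qed.

(** The regularity matches a classical solution: C^2 up to and across the pole but only below the
    boundary height [T], and mere continuity at [T]. *)
Record profile (T : R) (phi phi1 phi2 : R -> R) : Prop := Profile {
  profile_d1 : forall t, 0 <= t < T -> is_derive t 1 phi (phi1 t);
  profile_d2 : forall t, 0 <= t < T -> is_derive t 1 phi1 (phi2 t);
  profile_c2 : forall t, 0 <= t < T -> {for t, continuous phi2};
  profile_c : forall t, 0 <= t <= T -> {for t, continuous phi} }.

Definition radial_op (phi1 phi2 : R -> R) (t : R) : R :=
  t * (2 - t) * phi2 t + N%:R * (1 - t) * phi1 t.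

Lemma eq_primitives (y Y1 Y2 : R -> R) (t T : R) : t <= T ->
  (forall s, t <= s <= T -> is_derive s 1 Y1 (y s)) ->
  (forall s, t <= s <= T -> is_derive s 1 Y2 (y s)) ->
  Y1 T - Y1 t = Y2 T - Y2 t.
Proof.
move=> tT d1 d2.
have le (A B : R -> R) : (forall s, t <= s <= T -> is_derive s 1 A (y s)) ->
    (forall s, t <= s <= T -> is_derive s 1 B (y s)) -> A t - B t <= A T - B T.
  move=> dA dB.
  have dAB (s : R) : t <= s <= T -> is_derive s 1 (fun s => A s - B s) (y s - y s).
    by move=> sT; exact: (is_deriveB (dA s sT) (dB s sT)).
  apply: (@nondecreasing_of_derive R (fun s => A s - B s) (fun s => y s - y s) t T tT).
  - by move=> s /andP[/ltW ts /ltW sT]; apply: dAB; rewrite ts.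
  - by move=> s _; rewrite subrr.
  - move=> s sT; apply/differentiable_continuous/derivable1_diffP.
    by have [] := dAB s sT.
by have := le _ _ d1 d2; have := le _ _ d2 d1; lra.
Qed.

Section solve.
Variables (f : R -> R) (T a s k : R).
Hypotheses (T02 : 0 < T < 2) (df : forall x, derivable f x 1).
Hypotheses (fmono : {homo f : x y / x <= y}) (f0 : 0 < f 0).
Hypotheses (a0 : 0 < a) (s0 : 0 < s) (fs : f s = a * s).
Hypothesis flip : forall x y, 0 <= x -> x <= y -> y <= s -> f y - f x <= a * (y - x).
Hypothesis k01 : 0 < k < 1.

Let lam := k / (a * D T).
(** Truncating the argument to [[0, s]] makes the nonlinearity globally [a]-Lipschitz, so the
    iteration may start from any continuous function; the fixed point is shown afterwards to lie in
    [[0, s]], where [F] agrees with [f]. *)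
Let F x := f (clamp 0 s x).

Let DT0 : 0 < D T.
Proof.
by have := @hsum_lt R N N2 0 T; rewrite hsum0; apply; have := T02; lra.
Qed.

Let lam0 : 0 < lam.
Proof. by rewrite divr_gt0 ?mulr_gt0//; case/andP: k01. Qed.

Let lamE : lam * a * D T = k.
Proof. by rewrite /lam; field; rewrite !gt_eqF. Qed.

Let cf : continuous f.
Proof. by move=> x; apply/differentiable_continuous/derivable1_diffP. Qed.

Let cF : continuous F.
Proof.
by move=> x; apply: (@continuous_comp _ _ _ (clamp 0 s) f); [exact: continuous_clamp|exact: cf].
Qed.

Let F_lip x y : `|F x - F y| <= a * `|x - y|.
Proof.
have s0' := ltW s0.
have cx := clamp_itv x s0'; have cy := clamp_itv y s0'.
apply: (@le_trans _ _ (a * `|clamp 0 s x - clamp 0 s y|)); last first.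
  by rewrite ler_pM2l// clamp_lipschitz.
rewrite /F; move: (clamp _ _ x) (clamp _ _ y) cx cy => {}x {}y.
wlog xy : x y / x <= y.
  move=> H hx hy; have [xy|/ltW xy] := leP x y; first exact: H.
  by rewrite distrC (distrC x); exact: H.
move=> /andP[x0 xs] /andP[y0 ys]; rewrite distrC (distrC x).
rewrite !ger0_norm ?subr_ge0//; last exact: fmono.
exact: flip.
Qed.

Let F_bound x : f 0 <= F x <= a * s.
Proof.
have /andP[cx0 cxs] := clamp_itv x (ltW s0).
by rewrite -fs /F !fmono.
Qed.

(** A relation, because [y] and [Y] come from existence statements. Continuity is asked on the whole
    line, the formula on [[0, T]] only. *)
Definition picard_step (w w' : R -> R) := continuous w' /\
  exists y Y : R -> R, [/\ green_for N T (F \o w) y,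
    (forall t : R, -1 < t < 2 -> is_derive t 1 Y (y t)) &
    forall t, 0 <= t <= T -> w' t = lam * (Y T - Y t)].

(** The premise [continuous w] stands under the existential so that [choice] yields an operator
    defined on all functions. *)
Let step_ex w : exists w', continuous w -> picard_step w w'.
Proof.
have [T0 T2] := andP T02.
have [cw|ncw] := pselect (continuous w); last by exists w => /ncw.
have cFw : continuous (F \o w).
  by move=> x; apply: continuous_comp; [exact: cw|exact: cF].
have [y gy] := green_function N2 T02 cFw.
have cy : continuous y by case: gy.
have [Y dY] := continuous_primitive (-1) 2 cy.
exists (fun t => lam * (Y T - Y (clamp 0 T t))) => _; split; last first.
  by exists y, Y; split => // t tT; rewrite clamp_id.
move=> t; have cc (r : R) : {for t, continuous (fun=> r)} by exact: cst_continuous.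
have cY : {for t, continuous (Y \o clamp 0 T)}.
  apply: continuous_comp; first exact: continuous_clamp.
  apply/differentiable_continuous/derivable1_diffP.
  have h : -1 < clamp 0 T t < 2 by have := clamp_itv t (ltW T0); lra.
  by have [] := dY _ h.
have cB : {for t, continuous (fun s => Y T - Y (clamp 0 T s))}.
  by apply: cvgB; [exact: cc|exact: cY].
exact: (continuous_mulf (cc lam) cB).
Qed.

(** The sources differ by at least [- a m], hence the primitives by at least
    [- a m (D T - D t) >= - a m D T], and [lam a D T = k]. Exchanging the two functions gives the
    other bound. *)
Let diff_lower w1 w1' w2 w2' m : picard_step w1 w1' -> picard_step w2 w2' ->
  (forall t, 0 <= t <= T -> `|w1 t - w2 t| <= m) ->
  forall t, 0 <= t <= T -> - (k * m) <= w1' t - w2' t.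
Proof.
have [T0 T2] := andP T02.
move=> [_ [y1 [Y1 [g1 d1 e1]]]] [_ [y2 [Y2 [g2 d2 e2]]]] wm t tT.
have m0 : 0 <= m by apply: le_trans (wm t tT).
have g := green_for_lin 1 (-1) g1 g2.
have lo : forall r, 0 <= r <= T -> - (a * m) * D1 r <= 1 * y1 r + -1 * y2 r.
  apply: (green_lower N2 T2 g) => r rT /=.
  have : `|F (w1 r) - F (w2 r)| <= a * m.
    by rewrite (le_trans (F_lip _ _))// ler_pM2l// wm.
  by rewrite ler_norml => /andP[]; lra.
have dY (r : R) : -1 < r < 2 -> is_derive r 1 (fun r => 1 * Y1 r + -1 * Y2 r) (1 * y1 r + -1 * y2 r).
  by move=> r2; exact: (is_deriveD (is_deriveZ 1 (d1 r r2)) (is_deriveZ (-1) (d2 r r2))).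
have := primitive_lower N2 T02 lo dY tT.
rewrite e1// e2// => h.
have Dt : 0 <= D t by apply: hsum_ge0 => //; lra.
have : - (a * m) * D T <= (Y1 T - Y1 t) - (Y2 T - Y2 t).
  have : 0 <= a * m * D t by rewrite !mulr_ge0// ltW.
  by move: h; lra.
rewrite -(ler_pM2l lam0) -lamE; lra.
Qed.

Lemma nonlinear_profile : exists phi phi1 phi2, [/\ profile T phi phi1 phi2,
  phi T = 0, (forall t, 0 <= t < T -> 0 < phi t) &
  forall t, 0 <= t < T -> radial_op phi1 phi2 t = - (lam * f (phi t))].
Proof.
have [T0 T2] := andP T02; have [k0 k1] := andP k01.
have [S SP] := choice step_ex.
have [w cw wS] : exists2 w, continuous w & forall t, 0 <= t <= T -> S w t = w t.
  apply: (@contraction_fixpoint R S k T); first exact: ltW.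
  - by rewrite (ltW k0).
  - by move=> w /SP[].
  - move=> w v m cw cv wv t tT; rewrite ler_norml; apply/andP; split.
      exact: (diff_lower (SP w cw) (SP v cv) wv tT).
    have vw r : 0 <= r <= T -> `|v r - w r| <= m by move=> rT; rewrite distrC wv.
    by have := diff_lower (SP v cv) (SP w cw) vw tT; lra.
have [_ [y [Y [gy dY wE]]]] := SP w cw.
pose g := F \o w.
have cg : continuous g by move=> x; apply: continuous_comp; [exact: cw|exact: cF].
have wY t : 0 <= t <= T -> w t = lam * (Y T - Y t) by move=> tT; rewrite -wS// wE.
have cy : continuous y by case: gy.
have lo t : 0 <= t <= T -> f 0 * (D T - D t) <= Y T - Y t.
  apply: (primitive_lower N2 T02 _ dY); apply: (green_lower N2 T2 gy) => r rT.
  by have /andP[] := F_bound (w r).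
have up t : 0 <= t <= T -> Y T - Y t <= a * s * (D T - D t).
  move=> tT; have g' := green_for_lin (-1) 0 gy gy.
  have lo' r : 0 <= r <= T -> - (a * s) * D1 r <= -1 * y r + 0 * y r.
    move: r; apply: (green_lower N2 T2 g') => r rT /=.
    by have /andP[_] := F_bound (w r); lra.
  have dY' (r : R) : -1 < r < 2 -> is_derive r 1 (fun r => -1 * Y r + 0 * Y r) (-1 * y r + 0 * y r).
    by move=> r2; exact: (is_deriveD (is_deriveZ (-1) (dY r r2)) (is_deriveZ 0 (dY r r2))).
  by have := primitive_lower N2 T02 lo' dY' tT; lra.
have DtT t : 0 <= t < T -> D t < D T by move=> /andP[t0 tT]; apply: hsum_lt; rewrite ?t0.
have DtT' t : 0 <= t <= T -> D t <= D T.
  by move=> /andP[t0]; rewrite le_eqVlt => /predU1P[->//|tT]; rewrite ltW// DtT// t0.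
(* The upper bound is [lam a s D T = k s <= s]: the same product that makes the iteration contract
   also deactivates the truncation. *)
have w_itv t : 0 <= t <= T -> 0 <= w t <= s.
  move=> tT; rewrite wY//; apply/andP; split.
    rewrite mulr_ge0 ?(ltW lam0)// (le_trans _ (lo _ tT))// mulr_ge0 ?(ltW f0)// subr_ge0.
    exact: DtT'.
  have Dt : 0 <= D t by apply: hsum_ge0 => //; lra.
  apply: (@le_trans _ _ (lam * (a * s * D T))).
    rewrite ler_pM2l// (le_trans (up _ tT))// ler_pM2l ?mulr_gt0//.
    by rewrite gerBl.
  rewrite (_ : _ * _ = (lam * a * D T) * s); last by ring.
  by rewrite lamE ler_piMl ?ltW.
have gf t : 0 <= t <= T -> g t = f (w t).
  by move=> tT; rewrite /g /= /F clamp_id// w_itv.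
have zT : 0 <= (0 : R) <= T by rewrite lexx ltW.
pose W t := lam * (Y T - Y t).
pose g1 := (derive1 f (w 0)) * (lam * (0 - y 0)).
have dW0 : is_derive (0 : R) 1 W (lam * (0 - y 0)).
  have d0 := dY 0 (ltac:(lra)).
  exact: (@is_deriveZ R R R (cst (Y T) - Y) lam 0 1 (0 - y 0) (is_deriveB (is_derive_cst (Y T) (0 : R) 1) d0)).
have dfW : is_derive (0 : R) 1 (f \o W) g1.
  have dfw : is_derive (W 0) 1 f (derive1 f (w 0)).
    by rewrite /W -(wY 0 zT) derive1E; exact: derivableP.
  exact: (is_derive1_comp dfw dW0).
(* To the right of 0, [g] equals [f \o W] with [W] differentiable at 0; this supplies the one-sided
   slope [g1] that [green_C1] requires. *)
have g_approx (e : R) : 0 < e -> \forall t \near 0^'+, `|g t - g 0 - g1 * t| <= e * t.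
  move=> e0; have h := derivable_right_approx dfW e0.
  have n1 : \forall t \near (0:R)^'+, t < T by apply: nbhs_right_lt.
  have n2 : \forall t \near (0:R)^'+, 0 < t by exact: nbhs_right_gt.
  apply: filterS3 h n1 n2 => t ht tT t0.
  have t0T : 0 <= t <= T by rewrite !ltW.
  by rewrite !gf// !wY.
have C1 := green_C1 N2 T02 cg gy g_approx.
cbv zeta in C1.
set beta := (g1 + g 0) / _ in C1.
(* The equation says nothing about [y] for [t < 0], so it is replaced there by its tangent line at 0
   and integrated again; the new primitive [phi] is C^2 across 0 and equals [w] on [[0, T]]. *)
pose yx t := if t <= 0 then g 0 / N%:R + beta * t else y t.
pose y1 t := if t <= 0 then beta else (g t - N%:R * (1 - t) * y t) / (t * (2 - t)).
have {}C1 t : t < T -> is_derive t 1 yx (y1 t) /\ {for t, continuous y1} by exact: C1.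
have y0E : y 0 = g 0 / N%:R by case: gy.
have yxy t : 0 <= t -> yx t = y t.
  rewrite le_eqVlt /yx => /predU1P[<-|t0]; last by rewrite leNgt t0.
  by rewrite lexx mulr0 addr0 y0E.
have cyx : continuous yx.
  move=> t; have [tT|tT] := ltP t T.
    by apply/differentiable_continuous/derivable1_diffP; have [[]] := C1 t tT.
  have t0 : 0 < t by apply: lt_le_trans tT.
  have n : \forall r \near t, y r = yx r.
    by apply: filterS (lt_nbhsr t0) => r r0; rewrite yxy// ltW.
  rewrite /continuous_at -(nbhs_singleton n); apply: cvg_trans (near_eq_cvg n) _.
  exact: cy.
have [Yx dYx] := continuous_primitive (-1) 2 cyx.
pose phi t := lam * (Yx T - Yx t).
have phiw t : 0 <= t <= T -> phi t = w t.
  move=> /andP[t0 tT]; rewrite wY ?t0//; congr (lam * _).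
  apply: (@eq_primitives yx) => // r /andP[tr rT].
    by apply: dYx; lra.
  by rewrite yxy ?(le_trans t0)//; apply: dY; lra.
exists phi, (fun t => lam * (0 - yx t)), (fun t => lam * (0 - y1 t)).
have dphi (t : R) : 0 <= t <= T -> is_derive t 1 phi (lam * (0 - yx t)).
  move=> tT; have d0 := dYx t (ltac:(lra)).
  exact: (is_deriveZ lam (is_deriveB (is_derive_cst (Yx T) t 1) d0)).
split.
- split.
  + by move=> t /andP[t0 tT]; apply: dphi; rewrite t0 ltW.
  + move=> t /andP[t0 tT]; have [d _] := C1 t tT.
    exact: (is_deriveZ lam (is_deriveB (is_derive_cst (0 : R) t 1) d)).
  + move=> t /andP[t0 tT]; have [_ c] := C1 t tT.
    have cc (r : R) : {for t, continuous (fun=> r)} by exact: cst_continuous.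
    have cB : {for t, continuous (fun r => 0 - y1 r)}.
      by apply: cvgB; [exact: cc|exact: c].
    exact: (continuous_mulf (cc lam) cB).
  + move=> t tT; apply/differentiable_continuous/derivable1_diffP.
    by have [] := dphi t tT.
- by rewrite /phi subrr mulr0.
- move=> t /[dup] tT' /andP[t0 tT]; have t0T : 0 <= t <= T by rewrite t0 ltW.
  rewrite phiw// wY// mulr_gt0//; apply: lt_le_trans (lo _ t0T).
  by rewrite mulr_gt0// subr_gt0 DtT.
- move=> t /andP[t0 tT]; have t0T : 0 <= t <= T by rewrite t0 ltW.
  rewrite phiw// -gf// /radial_op.
  have NN : N%:R != 0 :> R by rewrite pnatr_eq0; case: N N2.
  (* At the pole the second-order term vanishes and the equation is the initial value
     [y 0 = g 0 / N]. *)
  move: t0; rewrite le_eqVlt => /predU1P[<-|t0].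
    by rewrite yxy// y0E; field.
  rewrite yxy ?ltW// /y1 leNgt t0/=.
  by field; apply/andP; split; lra.
Qed.

End solve.
End nonlinear_profile.

(** * Bounds on eigenvalues and on the parameter *)

Section caps.
Context {R : realType}.
Implicit Type eps : R.

Definition cap_height eps : R := 1 - cos ((1 - eps) * pi).

Lemma cap_height_itv eps : 0 < eps < 1 -> 0 < cap_height eps < 2.
Proof.
move=> /andP[e0 e1]; have pi0 := pi_gt0 R.
have x0 : 0 < (1 - eps) * pi by rewrite mulr_gt0// subr_gt0.
have xpi : (1 - eps) * pi < pi by rewrite gtr_pMl// gtrBl.
have c1 : cos ((1 - eps) * pi) < 1.
  by rewrite -[ltRHS]cos0 ltr_cos ?in_itv/= ?lexx ?ltW//= pi_ge0.
have c2 : - 1 < cos ((1 - eps) * pi).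
  by rewrite -cospi ltr_cos ?in_itv/= ?lexx ?pi_ge0 ?ltW//.
by rewrite /cap_height; lra.
Qed.

Lemma near_cap_height (d : R) : 0 < d ->
  \forall eps \near 0^'+, 2 - d < cap_height eps < 2.
Proof.
move=> d0.
have c : (fun eps => cos ((1 - eps) * pi)) @ (0 : R) --> cos ((1 - 0) * pi).
  apply: (@continuous_comp _ _ _ (fun e : R => (1 - e) * pi) cos); last exact: continuous_cos.
  by apply: cvgM; [apply: cvgB; [exact: cvg_cst|exact: cvg_id]|exact: cvg_cst].
rewrite subr0 mul1r cospi in c.
have n : \forall eps \near (0 : R), cos ((1 - eps) * pi) < -1 + d.
  by apply: (cvgr_lt _ c); rewrite ltrDl.
have n' : \forall eps \near (0 : R)^'+, cos ((1 - eps) * pi) < -1 + d.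
  by rewrite near_withinE; apply: filterS n.
have e1 : \forall eps \near (0 : R)^'+, eps < 1 by exact: nbhs_right_lt.
have e0 : \forall eps \near (0 : R)^'+, 0 < eps by exact: nbhs_right_gt.
apply: filterS3 n' e1 e0 => eps h h1 h0.
have /andP[_] : 0 < cap_height eps < 2 by rewrite cap_height_itv// h0.
by rewrite /cap_height => ->; lra.
Qed.

End caps.

Section radial_solutions.
Context {R : realType} (N : nat).
Hypothesis N2 : (2 <= N)%N.
Notation V := 'rV[R]_N.+1.
Notation D := (hsum N (0 : R)).
Notation D1 := (hsum1 N (0 : R)).
Implicit Types (eps : R) (x : V).
Let z01 : 0 <= (0 : R) <= 1. Proof. by rewrite lexx ler01. Qed.

Lemma cap_heightP eps x : cap eps x ->
  sphere x /\ 0 <= 1 - x 0 ord_max < cap_height eps.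
Proof.
move=> [sx /andP[h1 h2]]; split => //.
by rewrite subr_ge0 h2 /cap_height ltrD2l ltrN2.
Qed.

Lemma cap_cl_heightP eps x : cap_cl eps x ->
  0 <= 1 - x 0 ord_max <= cap_height eps.
Proof.
move=> /cap_clP[sx h]; rewrite subr_ge0 sphere_coord_le1//=.
by rewrite /cap_height lerD2l lerN2.
Qed.

Section of_profile.
Variables (eps : R) (phi phi1 phi2 : R -> R).
Hypothesis phiP : profile (cap_height eps) phi phi1 phi2.
Let u := fun x : V => phi (1 - x 0 ord_max).

Lemma C2_near_profile : C2_near (hext u) (cap eps).
Proof.
apply: (C2_near_radial (profile_d1 phiP) (profile_d2 phiP) (profile_c2 phiP)).
by move=> x /cap_heightP[sx /andP[]].
Qed.

Lemma continuous_profile : {within cap_cl eps, continuous u}.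
Proof.
apply: continuous_in_subspaceT => x; rewrite inE => /cap_cl_heightP h.
apply: (@continuous_comp _ _ _ (fun x : V => 1 - x 0 ord_max) phi).
  exact: (has_grad_cont (has_gradD (has_grad_cst (1 : R) x)
    (has_gradN (has_grad_coord ord_max x)))).
exact: (profile_c phiP).
Qed.

Lemma lapS_profile x : cap eps x -> lapS u x = radial_op N phi1 phi2 (1 - x 0 ord_max).
Proof.
move=> /cap_heightP[sx /andP[_ h]].
exact: (lapS_radial (profile_d1 phiP) (profile_d2 phiP) sx h).
Qed.

Lemma dirichlet_profile : phi (cap_height eps) = 0 -> classical_dirichlet eps u.
Proof.
move=> phiT; split; first exact: C2_near_profile.
split; first exact: continuous_profile.
by move=> x [_ xE]; rewrite /u xE.
Qed.

End of_profile.

Lemma profile_hsum (a b l T : R) : 0 <= l <= 1 -> T < 2 ->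
  profile T (fun t => a + b * hsum N l t) (fun t => 0 + b * hsum1 N l t)
    (fun t => 0 + b * hsum2 N l t).
Proof.
move=> l01 T2.
have abs (t : R) : 0 <= t <= T -> `|t| < 2.
  by move=> /andP[t0 tT]; rewrite ger0_norm// (le_lt_trans tT).
have d1 (t : R) : 0 <= t <= T ->
    is_derive t 1 (fun t => a + b * hsum N l t) (0 + b * hsum1 N l t).
  move=> /abs t2; exact: (is_deriveD (is_derive_cst a t 1) (is_deriveZ b (is_derive_hsum N2 l01 t2))).
split.
- by move=> t /andP[t0 tT]; apply: d1; rewrite t0 ltW.
- move=> t /andP[t0 tT]; have t2 : `|t| < 2 by apply: abs; rewrite t0 ltW.
  exact: (is_deriveD (is_derive_cst (0 : R) t 1) (is_deriveZ b (is_derive_hsum1 N2 l01 t2))).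
- move=> t /andP[t0 tT]; have t2 : `|t| < 2 by apply: abs; rewrite t0 ltW.
  have cc (r : R) : {for t, continuous (fun=> r)} by exact: cst_continuous.
  exact: (continuous_addf (cc 0) (continuous_mulf (cc b) (continuous_hsum2 N2 l01 t2))).
- move=> t tT; apply/differentiable_continuous/derivable1_diffP.
  by have [] := d1 t tT.
Qed.

Lemma hsum_gt0 (t : R) : 0 < t < 2 -> 0 < D t.
Proof.
by move=> /andP[t0 t2]; have := @hsum_lt R N N2 0 t; rewrite hsum0 lexx; exact.
Qed.

Lemma eigenvalue_lower eps mu : 0 < eps < 1 -> dir_eigenvalue N eps mu ->
  (D (cap_height eps))^-1 <= mu.
Proof.
move=> /cap_height_itv; set T := cap_height eps => T02 ev.
have [T0 T2] := andP T02; have DT := hsum_gt0 T02.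
(* The supersolution is [W = D T + d - D], with [- Delta W = 1]. The shift [d] makes it positive up
   to the boundary; [2 * d] gives strictness at the pole, where [W] equals [D T + d]. *)
have bound d : 0 < d -> (D T + 2 * d)^-1 < mu.
  move=> d0; have P := profile_hsum (D T + d) (-1) z01 T2.
  have tau t : 0 <= t <= T -> 0 <= D t <= D T.
    move=> /andP[t0 tT]; rewrite hsum_ge0//; last by rewrite t0 (le_lt_trans tT).
    move: tT; rewrite le_eqVlt => /predU1P[->|tT]; first exact: lexx.
    by apply: ltW; apply: (hsum_lt N2) T2; rewrite t0.
  apply: (barta (C2_near_profile P) (continuous_profile P)) ev.
  - by move=> x /cap_cl_heightP/tau; lra.
  - move=> x xc; rewrite (lapS_profile P)//; have [_ h] := cap_heightP xc.
    have {}h : 0 <= 1 - x 0 ord_max <= T by case/andP: h => ->/ltW ->.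
    have t2 : `|1 - x 0 ord_max| < 2.
      by case/andP: h => h0 hT; rewrite ger0_norm// (le_lt_trans hT).
    have := hsum_ode N2 z01 t2; rewrite mul0r subr0 /radial_op => E.
    move: (1 - x 0 ord_max) h t2 E => t h _ E.
    rewrite (_ : - (t * _ * _ + _) = 1); last by rewrite -[RHS]E; ring.
    have := tau _ h; move: (D t) => y /andP[y0 yT].
    by rewrite mulrC ltr_pdivrMr ?mul1r; lra.
have mu0 : 0 < mu.
  by apply: lt_trans (bound 1 ltr01); rewrite invr_gt0; lra.
rewrite leNgt; apply/negP => h.
have md : mu * D T < 1 by rewrite -ltr_pdivlMr// mul1r.
(* For this [d] one has [D T + 2 d = 1 / mu], so the bound would read [mu < mu]. *)
have := bound ((1 - mu * D T) / (2 * mu)); rewrite divr_gt0 ?mulr_gt0 ?subr_gt0// => /(_ isT).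
rewrite (_ : D T + _ = mu^-1) ?invrK ?ltxx//.
by field; rewrite gt_eqF.
Qed.

(** The boundary value [1 - l D_l T] is 1 at [l = 0]. At [l1 = (1 + eta) / D T] the bound
    [D_l >= (1 - l) D] makes it at most [(1 + eta)^2 / D T - eta], which is nonpositive exactly
    under the assumed threshold. A zero in between is an eigenvalue, with an eigenfunction equal to
    1 at the pole. *)
Lemma eigenvalue_upper eps eta : 0 < eps < 1 -> 0 < eta ->
  (1 + eta) ^+ 2 / eta <= D (cap_height eps) ->
  exists2 l, dir_eigenvalue N eps l & l <= (1 + eta) / D (cap_height eps).
Proof.
move=> /cap_height_itv; set T := cap_height eps => T02 eta0 hD.
have [T0 T2] := andP T02; have DT := hsum_gt0 T02.
rewrite ler_pdivrMr// in hD.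
have eta1 : 1 + eta <= D T by nra.
pose l1 := (1 + eta) / D T.
have l10 : 0 < l1 by rewrite divr_gt0//; lra.
have l11 : l1 <= 1 by rewrite ler_pdivrMr// mul1r.
have T02' : 0 <= T < 2 by rewrite ltW.
pose G l := 1 - l * hsum N l T.
have Glip l m : 0 <= l <= 1 -> 0 <= m <= 1 -> `|G l - G m| <= 3 * D T * `|l - m|.
  move=> l01 m01; have h := hsum_lipschitz N2 l01 m01 T02'.
  have hm := hsum_lipschitz N2 m01 z01 T02'.
  have [/andP[l0 l1'] /andP[m0 m1]] := (l01, m01).
  have hm' : `|hsum N m T| <= 2 * D T.
    move: hm; rewrite subr0 (ger0_norm m0) ler_norml => /andP[h1 h2].
    have : m * D T <= D T by rewrite ler_piMl// ltW.
    by rewrite ler_norml => ?; apply/andP; lra.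
  rewrite /G (_ : _ - _ = - (l * (hsum N l T - hsum N m T) + (l - m) * hsum N m T)); last by ring.
  rewrite normrN (le_trans (ler_normD _ _))// !normrM (ger0_norm l0).
  have : l * `|hsum N l T - hsum N m T| <= 1 * (`|l - m| * D T) by rewrite ler_pM.
  have : `|l - m| * `|hsum N m T| <= `|l - m| * (2 * D T) by rewrite ler_wpM2l.
  by lra.
have [l lI Gl] : exists2 l, l \in `[0, l1] & G l = 0.
  (* The Lipschitz estimate holds for parameters in [[0, 1]]; clamping gives a function continuous
     on the whole line. *)
  pose Gc l := G (clamp 0 1 l).
  have cGc : continuous Gc.
    move=> t; apply/cvgrPdist_lt => e e0.
    have De : 0 < e / (3 * D T) by rewrite divr_gt0// mulr_gt0.
    have n : \forall s \near t, `|t - s| < e / (3 * D T).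
      by apply: (cvgr_dist_lt _ _ (@cvg_id _ (nbhs t))).
    apply: filterS n => s h.
    rewrite (le_lt_trans (Glip _ _ (clamp_itv t ler01) (clamp_itv s ler01)))//.
    rewrite -ltr_pdivlMl ?mulr_gt0//; apply: le_lt_trans (clamp_lipschitz _ _ _ _) _.
    by rewrite mulrC.
  have Gc0 : Gc 0 = 1 by rewrite /Gc clamp_id ?lexx ?ler01// /G mul0r subr0.
  have Gc1 : Gc l1 <= 0.
    have l101 : 0 <= l1 <= 1 by rewrite ltW.
    rewrite /Gc clamp_id// /G subr_le0.
    have := hsum_lipschitz N2 l101 z01 T02'; rewrite subr0 (ger0_norm (ltW l10)) ler_norml.
    move=> /andP[h _].
    have {}h : (1 - l1) * D T <= hsum N l1 T by lra.
    apply: (@le_trans _ _ (l1 * ((1 - l1) * D T))); last by rewrite ler_pM2l.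
    have -> : l1 * ((1 - l1) * D T) = (1 + eta) - (1 + eta) ^+ 2 / D T.
      by rewrite /l1; field; rewrite gt_eqF.
    rewrite lerBrDr -lerBrDl (_ : 1 + eta - 1 = eta); last by ring.
    by rewrite ler_pdivrMr// mulrC.
  have [||l lI h] := @IVT R Gc 0 l1 0 (ltW l10).
  - exact: continuous_subspaceT.
  - by rewrite Gc0 ge_min le_max ler01 Gc1 orbT.
  exists l => //; move: h lI; rewrite /Gc in_itv/= => + /andP[h0 h1].
  by rewrite clamp_id// h0 (le_trans h1).
move: lI; rewrite in_itv/= => /andP[l0 ll1]; exists l => //.
have l01 : 0 <= l <= 1 by rewrite l0 (le_trans ll1).
have P := profile_hsum 1 (- l) l01 T2.
exists (fun x : V => 1 + - l * hsum N l (1 - x 0 ord_max)).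
split; first by apply: (dirichlet_profile P); rewrite -[RHS]Gl /G mulNr.
split.
  exists (delta_mx 0 ord_max); have s1 : sphere (delta_mx 0 ord_max : V).
    rewrite /sphere/= (bigD1 ord_max)//= mxE !eqxx expr1n big1 ?addr0// => i im.
    by rewrite mxE eqxx/= (negbTE im) expr0n.
  split; last by rewrite mxE !eqxx subrr hsum0 mulr0 addr0 oner_eq0.
  split=> //; rewrite mxE !eqxx /= lexx andbT.
  by rewrite -subr_gt0.
move=> x xc; rewrite (lapS_profile P)//; have [_ /andP[h0 hT]] := cap_heightP xc.
have t2 : `|1 - x 0 ord_max| < 2 by rewrite ger0_norm// (lt_trans hT).
have := hsum_ode N2 l01 t2; rewrite /radial_op.
move: (1 - x 0 ord_max) => t E.
rewrite (_ : - (t * _ * _ + _) = l * (t * (2 - t) * hsum2 N l t + N%:R * (1 - t) * hsum1 N l t)); last by ring.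
by rewrite E; ring.
Qed.

Lemma positive_solution_bound (f : R -> R) (a eps lam mu : R) (u : V -> R) :
  0 < a -> 0 < f 0 -> 0 < lam ->
  (forall s, 0 <= s -> a * s <= f s) -> {homo f : x y / x <= y} ->
  classical_pos_sol f eps lam u -> dir_eigenvalue N eps mu -> lam * a <= mu.
Proof.
move=> a0 f0 lam0 fa fmono [[Cu [cu bu]] [u0 Lu]] ev.
have bound th : 0 < th < 1 -> (1 - th) * (lam * a) < mu.
  (* The share [th] of [f u] is bounded below by [th * f 0 = a * d], which pays for the added
     constant, and the share [1 - th] by [a * u]; strictness comes from [1 - th < 1]. *)
  move=> /andP[th0 th1]; pose d := th * f 0 / a.
  have d0 : 0 < d by rewrite divr_gt0 ?mulr_gt0.
  have E : hext (fun x => u x + d) = (fun x => 1 * hext u x + d).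
    by apply/funext => x; rewrite /hext mul1r.
  apply: (@barta R N eps _ mu (fun x => u x + d)) ev.
  - by rewrite E; exact: C2_near_lin.
  - rewrite continuous_subspace_in => x xA; apply: cvgD; last exact: cvg_cst.
    exact: cu.
  - by move=> x [/u0 h|/bu ->]; lra.
  - move=> x xc; rewrite /lapS E (lapl_lin _ _ Cu)// mul1r -[lapl _ x]/(lapS u x) Lu//.
    have ux := u0 x xc.
    have h1 := fa _ (ltW ux); have h2 : f 0 <= f (u x) by apply: fmono; exact: ltW.
    have -> : (1 - th) * (lam * a) * (u x + d) =
        lam * ((1 - th) * (a * u x) + (1 - th) * (th * f 0)).
      by rewrite /d; field; rewrite gt_eqF.
    rewrite ltr_pM2l//.
    have : (1 - th) * (a * u x) <= (1 - th) * f (u x) by rewrite ler_pM2l; lra.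
    have : (1 - th) * (th * f 0) < th * f 0 by rewrite gtr_pMl ?mulr_gt0//; lra.
    have : th * f 0 <= th * f (u x) by rewrite ler_pM2l.
    by lra.
have la0 : 0 < lam * a by rewrite mulr_gt0.
have mu0 : 0 < mu.
  have h : 0 < (2^-1 : R) < 1 by lra.
  by apply: lt_trans (bound _ h); rewrite mulr_gt0//; lra.
rewrite leNgt; apply/negP => h.
(* With this [th] the left-hand side of the bound is [mu] itself. *)
have := bound (1 - mu / (lam * a)); rewrite subr_gt0 gtrBl divr_gt0//.
rewrite ltr_pdivrMr// mul1r h => /(_ isT).
by rewrite subKr divfK ?ltxx// gt_eqF.
Qed.

End radial_solutions.

(** * The minimal slope [a_*] and chords of [f] *)

Section slope.
Context {R : realType}.
Variable f : R -> R.
Hypotheses (cf : continuous f) (fmono : {homo f : x y / x <= y}) (f0 : 0 < f 0).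

Lemma astar_attained : f s / s @[s --> +oo] --> +oo ->
  exists2 s, 0 < s & f s = astar f * s /\ 0 < astar f /\
    forall x, 0 <= x -> astar f * x <= f x.
Proof.
move=> finf.
have f1 : 0 < f 1 by apply: lt_le_trans f0 _; exact: fmono.
have [b0 [_ b0P]] : \forall s \near +oo, f 1 <= f s / s by move/cvgryPge : finf; apply.
(* Outside [[a, b]] the quotient is at least its value [f 1] at 1: for [x < a] because
   [f x >= f 0 >= f 1 * x], beyond [b0] by the growth assumption. As 1 lies in [[a, b]], the minimum
   there is global. *)
pose b := Num.max b0 1 + 1; pose a := f 0 / f 1.
have m1 : 1 <= Num.max b0 1 by rewrite le_max lexx orbT.
have b1 : 1 <= b by rewrite /b; lra.
have bb0 : b0 < b by rewrite /b ltr_pwDr// le_max lexx.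
have a0 : 0 < a by rewrite divr_gt0.
have a1 : a <= 1 by rewrite ler_pdivrMr// mul1r fmono.
have cq : {within `[a, b], continuous (fun s => f s / s)}.
  apply: continuous_in_subspaceT => s; rewrite inE/= in_itv/= => /andP[sa _].
  apply: cvgM; first exact: cf.
  by apply: cvgV; [rewrite gt_eqF// (lt_le_trans a0)|exact: cvg_id].
have [s sab smin] := EVT_min (le_trans a1 b1) cq.
have s0 : 0 < s by move: sab; rewrite in_itv/= => /andP[sa _]; exact: lt_le_trans sa.
have s1 : f s / s <= f 1.
  by have := smin 1; rewrite divr1; apply; rewrite in_itv/= a1.
have glob x : 0 < x -> f s / s <= f x / x.
  move=> x0; have [xa|ax] := ltP x a.
    rewrite (le_trans s1)// ler_pdivlMr//.
    rewrite (le_trans _ (fmono (ltW x0)))//.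
    by rewrite mulrC -ler_pdivlMr// ltW.
  have [xb|bx] := leP x b; first by apply: smin; rewrite in_itv/= ax.
  by rewrite (le_trans s1)// b0P// (lt_trans bb0).
have aE : astar f = f s / s.
  apply/eqP; rewrite eq_le; apply/andP; split.
    apply: ge_inf; last by exists s.
    by exists (f s / s) => _ [x /= x0 <-]; exact: glob.
  apply: lb_le_inf; first by exists (f 1 / 1), 1 => //=.
  by move=> _ [x /= x0 <-]; exact: glob.
exists s => //; rewrite aE divfK ?gt_eqF//; split=> //; split.
  by rewrite divr_gt0// (lt_le_trans f0)// fmono// ltW.
move=> x; rewrite le_eqVlt => /predU1P[<-|x0]; first by rewrite mulr0 ltW.
by rewrite -ler_pdivlMr// glob.
Qed.

(* The line [x |-> a x] supports [f] at [s], so the slopes of chords of [f] to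
   the left of [s] are at most [a]. *)
Lemma chord_slope_le (a s x y : R) :
  (forall x y t, 0 <= t <= 1 -> f (t * x + (1 - t) * y) <= t * f x + (1 - t) * f y) ->
  f s = a * s -> (forall x, 0 <= x -> a * x <= f x) ->
  0 <= x -> x <= y -> y <= s -> f y - f x <= a * (y - x).
Proof.
move=> conv fs fa x0; rewrite le_eqVlt => /predU1P[->|xy] ys; first by rewrite !subrr mulr0.
have sx : 0 < s - x by lra.
pose t := (s - y) / (s - x).
have t01 : 0 <= t <= 1 by rewrite /t ler_pdivrMr// divr_ge0//; lra.
have yE : y = t * x + (1 - t) * s by rewrite /t; field; rewrite gt_eqF.
have := conv x s t t01; rewrite -yE => h.
have t1 : (1 - t) * (f s - f x) <= (1 - t) * (a * (s - x)).
  by rewrite ler_wpM2l; [|lra|rewrite fs; have := fa x x0; lra].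
have -> : a * (y - x) = (1 - t) * (a * (s - x)) by rewrite {1}yE; ring.
by lra.
Qed.

End slope.

Lemma lamstar_ge (R : realType) (N : nat) (f : R -> R) (eps k : R) (s : R) :
  (2 <= N)%N -> (forall x : R, derivable f x 1) ->
  (forall (x y t : R), 0 <= t <= 1 ->
     f (t * x + (1 - t) * y) <= t * f x + (1 - t) * f y) ->
  {homo f : x y / x <= y} -> 0 < f 0 -> 0 < s -> f s = astar f * s ->
  0 < astar f -> (forall x, 0 <= x -> astar f * x <= f x) ->
  0 < eps < 1 -> 0 < k < 1 ->
  ((k / (astar f * hsum N 0 (cap_height eps)))%:E <= lamstar N f eps)%E.
Proof.
move=> N2 df conv fmono f0 s0 fs a0 fa eps01 k01.
have T02 := cap_height_itv eps01.
have [phi [phi1 [phi2 [P phiT phi0 ode]]]] := nonlinear_profile N2 T02 df fmono f0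
  a0 s0 fs (fun x y => chord_slope_le conv fs fa) k01.
apply: ereal_sup_ubound; exists (k / (astar f * hsum N 0 (cap_height eps))) => //.
split.
  by case/andP: k01 => k0 _; rewrite divr_gt0// mulr_gt0// hsum_gt0.
exists (fun x : 'rV[R]_N.+1 => phi (1 - x 0 ord_max)); split; [|split].
- exact: (dirichlet_profile N P phiT).
- by move=> x /cap_heightP[_ h]; exact: phi0.
- move=> x xc; have [_ h] := cap_heightP xc.
  by rewrite (lapS_profile P)// ode// opprK.
Qed.

Theorem theorem1p3 (R : realType) (N : nat) (f : R -> R) :
  (2 <= N)%N ->
  (* f in C^2(R) *)
  (forall x : R, derivable f x 1) ->
  (forall x : R, derivable (derive1 f) x 1) ->
  continuous (derive1 (derive1 f)) ->
  (* convex *)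
  (forall (x y t : R), 0 <= t <= 1 ->
     f (t * x + (1 - t) * y) <= t * f x + (1 - t) * f y) ->
  (* monotone increasing *)
  {homo f : x y / x <= y} ->
  0 < f 0 ->
  f s / s @[s --> +oo] --> +oo ->
  ((lamstar N f eps * ((astar f) / lambda1 N eps)%:E)%E
     @[eps --> 0^'+] --> 1%E).
Proof.
move=> N2 df _ _ conv fmono f0 finf.
have cf : continuous f by move=> x; apply/differentiable_continuous/derivable1_diffP.
have [s s0 [fs [a0 fa]]] := astar_attained cf fmono f0 finf.
have main (eta : R) : 0 < eta -> \forall eps \near 0^'+, exists2 r : R,
    (lamstar N f eps * ((astar f) / lambda1 N eps)%:E)%E = r%:E & (1 + eta)^-1 <= r <= 1.
  move=> eta0; have [d d0 dP] := hsum_unbounded N2 ((1 + eta) ^+ 2 / eta).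
  have n1 := near_cap_height d0.
  have e1 : \forall eps \near (0 : R)^'+, eps < 1 by exact: nbhs_right_lt.
  have e0 : \forall eps \near (0 : R)^'+, 0 < eps by exact: nbhs_right_gt.
  apply: filterS3 n1 e1 e0 => eps hT eps1 eps0.
  have eps01 : 0 < eps < 1 by rewrite eps0.
  have T02 := cap_height_itv eps01.
  have hD := dP _ hT; have DT := hsum_gt0 N2 T02.
  set Dt := hsum N 0 (cap_height eps) in hD DT *.
  have [l evl ll] := eigenvalue_upper N2 eps01 eta0 (ltW hD).
  have evs : [set lam | dir_eigenvalue N eps lam] !=set0 by exists l.
  have lowD : Dt^-1 <= lambda1 N eps.
    by apply: lb_le_inf => // mu; exact: eigenvalue_lower.
  have upD : lambda1 N eps <= (1 + eta) / Dt.
    apply: le_trans ll; apply: ge_inf => //.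
    by exists Dt^-1 => mu; exact: eigenvalue_lower.
  have lam10 : 0 < lambda1 N eps by apply: lt_le_trans lowD; rewrite invr_gt0.
  have up : (lamstar N f eps <= (lambda1 N eps / astar f)%:E)%E.
    apply: ge_ereal_sup => _ [lam [lam0 [u uP]] <-]; rewrite lee_fin ler_pdivlMr//.
    by apply: lb_le_inf => // mu; exact: (positive_solution_bound a0 f0 lam0 fa fmono uP).
  have lo k : 0 < k < 1 -> ((k / (astar f * Dt))%:E <= lamstar N f eps)%E.
    exact: (lamstar_ge N2 df conv fmono f0 s0 fs a0 fa eps01).
  have h2 : 0 < (2^-1 : R) < 1 by lra.
  (* The lower bound with [k = 1/2] excludes the value -oo (the supremum of an empty set), and [up]
     excludes +oo. *)
  have h := lo _ h2; move: h up lo; case: (lamstar N f eps) => [L _|_|]; last 2 first.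
  - by rewrite leye_eq.
  - by rewrite leeNy_eq.
  rewrite lee_fin => LU lo.
  exists (L * (astar f / lambda1 N eps)); first by rewrite EFinM.
  apply/andP; split; last by rewrite mulrA ler_pdivrMr// mul1r -ler_pdivlMr.
  have aD : 0 < astar f * Dt by rewrite mulr_gt0.
  (* This is the limit [k -> 1]: if the product were below 1, the midpoint between it and 1 would be
     an admissible [k] contradicting [lo]. *)
  have Llo : 1 <= L * (astar f * Dt).
    rewrite leNgt; apply/negP => hL.
    have L0 : 0 < L * (astar f * Dt).
      by have := lo _ h2; rewrite lee_fin ler_pdivrMr//; lra.
    have := lo ((1 + L * (astar f * Dt)) / 2) (ltac:(lra)).
    by rewrite lee_fin ler_pdivrMr//; lra.
  rewrite ler_pdivlMr// in upD.
  rewrite mulrA ler_pdivlMr// -(ler_pM2r DT) -[in leRHS]mulrA (le_trans _ Llo)//.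
  by rewrite -mulrA mulrC ler_pdivrMr ?mul1r//; lra.
(* Finiteness near 0, from [main] with [eta = 1], reduces the limit in the extended reals to one in
   R. *)
pose rr eps := fine (lamstar N f eps * ((astar f) / lambda1 N eps)%:E)%E.
have fin : \forall eps \near 0^'+, (rr eps)%:E =
    (lamstar N f eps * ((astar f) / lambda1 N eps)%:E)%E.
  by apply: filterS (main 1 ltr01) => eps [r rE _]; rewrite /rr rE.
apply: cvg_trans (near_eq_cvg fin) _; apply: cvg_EFin; first exact: nearW.
apply/cvgrPdist_le => e e0; apply: filterS (main e e0) => eps [r rE /andP[r1 r2]].
rewrite /= /rr rE /= ger0_norm ?subr_ge0// lerBlDr -lerBlDl (le_trans _ r1)//.
rewrite -div1r ler_pdivlMr; last by lra.
by nra.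
Qed.
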